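(* Let $F:(M,E,g_M)\to(N,g_N)$ be an almost h-semi-slant Riemannian map from an almost quaternionic Hermitian manifold to a Riemannian manifold, with almost h-semi-slant angles $\{\theta_I,\theta_J,\theta_K\}$ not all equal to $\frac{\pi}{2}$ (that is, around each point of $M$ there is an almost h-semi-slant basis whose angles are not all $\frac{\pi}{2}$). Then the (nonempty) fibers $F^{-1}(x)$, $x\in N$, are even-dimensional submanifolds of $M$.
   Context: All manifolds and maps are $C^\infty$. An almost quaternionic Hermitian manifold $(M,E,g_M)$ is a $4m$-dimensional Riemannian manifold with a rank 3 subbundle $E\subset\mathrm{End}(TM)$ such that every point has a neighborhood $U$ on which $E$ has a local basis of sections $\{J_1,J_2,J_3\}$ with $J_\alpha^2=-\mathrm{id}$, $J_\alpha J_{\alpha+1}=-J_{\alpha+1}J_\alpha=J_{\alpha+2}$ (indices mod 3), and $g_M(J_\alpha X,J_\alpha Y)=g_M(X,Y)$; such a basis is called a quaternionic Hermitian basis. A map $F:(M,g_M)\to(N,g_N)$ is a Riemannian map if for every $p\in M$ the differential $(F_* )_p$ restricted to $(\ker (F_* )_p)^\perp$ is a linear isometry onto the image of $(F_* )_p$ (with metric induced from $g_N$). A Riemannian map $F:(M,E,g_M)\to(N,g_N)$ is an almost h-semi-slant Riemannian map if every $p\in M$ has a neighborhood $U$ with a quaternionic Hermitian basis $\{I,J,K\}$ of sections of $E$ on $U$ such that for each $R\in\{I,J,K\}$ there is a distribution $\mathcal{D}_1^R\subset\ker F_*$ on $U$ with $R(\mathcal{D}_1^R)=\mathcal{D}_1^R$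 and such that, with $\mathcal{D}_2^R$ the orthogonal complement of $\mathcal{D}_1^R$ in $\ker F_*$, the angle $\theta_R$ between $RX$ and $(\mathcal{D}_2^R)_q$ is constant for all nonzero $X\in(\mathcal{D}_2^R)_q$ and $q\in U$. Such a basis is called an almost h-semi-slant basis and $\{\theta_I,\theta_J,\theta_K\}$ the almost h-semi-slant angles. Convention: $\theta_R=0$ when $\mathcal{D}_2^R=0$. *)

(* Defs.v *)
From HB Require Import structures.
From mathcomp Require Import all_boot all_order all_algebra.
From mathcomp Require Import sesquilinear.
From mathcomp Require Import all_classical all_reals all_analysis.

Set Implicit Arguments.
Unset Strict Implicit.
Unset Printing Implicit Defensive.
Import Order.TTheory GRing.Theory Num.Theory numFieldNormedType.Exports.
Local Open Scope classical_set_scope.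
Local Open Scope ring_scope.

(* Meaningful for open A, the only case used below. *)
Fixpoint Ck (R : realType) (V W : normedModType R) (k : nat)
    (A : set V) (f : V -> W) : Prop :=
  if k is j.+1 then
    (forall x, A x -> differentiable f x) /\ (forall v, Ck j A ('D_v f))
  else forall x, A x -> {for x, continuous f}.

Definition smooth_on (R : realType) (V W : normedModType R)
    (A : set V) (f : V -> W) : Prop := forall k, Ck k A f.

(* A homeomorphism from an open subset of T onto an open subset of R^n; the
   functions are total, with irrelevant values off chart_dom and its image. *)
Record chart (R : realType) (T : topologicalType) (n : nat) := Chart {
  chart_dom : set T ;
  chart_to : T -> 'rV[R]_n ;
  chart_inv : 'rV[R]_n -> T ;
  chart_dom_open : open chart_dom ;
  chart_img_open : open (chart_to @` chart_dom) ;
  chart_invK : forall p, chart_dom p -> chart_inv (chart_to p) = p ;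
  chart_to_continuous :
    forall p, chart_dom p -> {for p, continuous chart_to} ;
  chart_inv_continuous :
    forall x, (chart_to @` chart_dom) x -> {for x, continuous chart_inv} }.

Definition smooth_transition (R : realType) (T : topologicalType) (n : nat)
    (c c' : chart R T n) : Prop :=
  smooth_on (chart_to c @` (chart_dom c `&` chart_dom c'))
            (chart_to c' \o chart_inv c).

Definition compatible (R : realType) (T : topologicalType) (n : nat)
    (c c' : chart R T n) : Prop :=
  smooth_transition c c' /\ smooth_transition c' c.

(* The atlas is presented as a family of charts indexed by the points, the
   chart with index p being a chart around p. *)
Record manifold (R : realType) (n : nat) := Manifold {
  manifold_sort :> topologicalType ;
  chart_at : manifold_sort -> chart R manifold_sort n ;
  manifold_hausdorff : hausdorff_space manifold_sort ;
  manifold_second_countable : @second_countable manifold_sort ;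
  chart_at_dom : forall p, chart_dom (chart_at p) p ;
  chart_at_compatible : forall p q, compatible (chart_at p) (chart_at q) }.
Arguments chart_at {R n} M p : rename.

Section Manifold.
Variables (R : realType) (n : nat) (M : manifold R n).

(* Every tangent space T_qM is 'rV[R]_n, a tangent vector at q being given by
   its components in the chart chart_at M q; coord_change p q turns them into
   its components in chart_at M p, for q in the domain of that chart. *)
Definition coord_change (p q : M) : 'rV[R]_n -> 'rV[R]_n :=
  'd (chart_to (chart_at M p) \o chart_inv (chart_at M q))
     (chart_to (chart_at M q) q).

Definition smooth_function (U : set M) (f : M -> R) : Prop :=
  forall p : M, smooth_on (W := R^o)
    (chart_to (chart_at M p) @` (U `&` chart_dom (chart_at M p)))
    (f \o chart_inv (chart_at M p)).

Definition smooth_field (U : set M) (X : M -> 'rV[R]_n) : Prop :=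
  forall p : M, smooth_on
    (chart_to (chart_at M p) @` (U `&` chart_dom (chart_at M p)))
    ((fun q => coord_change p q (X q)) \o chart_inv (chart_at M p)).

Definition smooth_endo (U : set M) (A : M -> 'End('rV[R]_n)) : Prop :=
  forall (V : set M) (X : M -> 'rV[R]_n), open V -> V `<=` U ->
    smooth_field V X -> smooth_field V (fun q => A q (X q)).

Record riemannian_metric := RiemannianMetric {
  metric_at :> M -> {dot 'rV[R]_n for idfun} ;
  metric_smooth : forall (U : set M) (X Y : M -> 'rV[R]_n), open U ->
    smooth_field U X -> smooth_field U Y ->
    smooth_function U (fun q => metric_at q (X q) (Y q)) }.

Definition distribution (U : set M) (D : M -> {vspace 'rV[R]_n}) : Prop :=
  exists r : nat, forall p, U p ->
  exists (V : set M) (X : 'I_r -> M -> 'rV[R]_n),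
    [/\ open_nbhs p V, V `<=` U, forall i, smooth_field V (X i)
      & forall q, V q -> basis_of (D q) [seq X i q | i : 'I_r]].

(* Indices modulo 3: {I, J, K} is {J 0, J 1, J 2}. *)
Definition quaternionic_basis (g : riemannian_metric)
    (E : M -> {vspace 'End('rV[R]_n)}) (U : set M)
    (J : 'Z_3 -> M -> 'End('rV[R]_n)) : Prop :=
  (forall a, smooth_endo U (J a)) /\
  forall q, U q ->
    [/\ basis_of (E q) [seq J a q | a : 'Z_3],
        forall a, (J a q \o J a q)%VF = - \1%VF,
        forall a, (J a q \o J (a + 1) q)%VF = J (a + 2) q,
        forall a, - (J (a + 1) q \o J a q)%VF = J (a + 2) q
      & forall a X Y, g q (J a q X) (J a q Y) = g q X Y].

Definition almost_quaternionic_hermitian (g : riemannian_metric)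
    (E : M -> {vspace 'End('rV[R]_n)}) : Prop :=
  forall p, exists (U : set M) (J : 'Z_3 -> M -> 'End('rV[R]_n)),
    open_nbhs p U /\ quaternionic_basis g E U J.

(* d is the dimension function of S: near each p in S, some chart of the
   differentiable structure of M turns S into a coordinate plane of
   dimension d p. *)
Definition submanifold (S : set M) (d : M -> nat) : Prop :=
  forall p, S p -> (d p <= n)%N /\
  exists c : chart R M n,
    [/\ chart_dom c p, forall q, compatible c (chart_at M q)
      & S `&` chart_dom c =
        [set q | chart_dom c q /\
                 forall i : 'I_n, (d p <= i)%N -> chart_to c q 0 i = 0]].

End Manifold.

(* The angle in [0, pi/2] between v != 0 and its orthogonal projection to W. *)
Definition angle (R : realType) (n : nat) (g : {dot 'rV[R]_n for idfun})
    (v : 'rV[R]_n) (W : {vspace 'rV[R]_n}) : R :=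
  let w := daddv_pi W (orthov g W) v in
  acos (Num.sqrt (g w w) / Num.sqrt (g v v)).

Section Maps.
Variables (R : realType) (m n : nat) (M : manifold R m) (N : manifold R n).

Definition smooth_map (F : M -> N) : Prop :=
  continuous F /\
  forall (p : M) (x : N), smooth_on
    (chart_to (chart_at M p) @`
       (chart_dom (chart_at M p) `&` F @^-1` chart_dom (chart_at N x)))
    (chart_to (chart_at N x) \o F \o chart_inv (chart_at M p)).

Definition differential (F : M -> N) (p : M) : 'Hom('rV[R]_m, 'rV[R]_n) :=
  linfun ('d (chart_to (chart_at N (F p)) \o F \o chart_inv (chart_at M p))
             (chart_to (chart_at M p) p)).

Definition riemannian_map (gM : riemannian_metric M)
    (gN : riemannian_metric N) (F : M -> N) : Prop :=
  smooth_map F /\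
  forall p, {in orthov (gM p) (lker (differential F p)) &, forall X Y,
    gN (F p) (differential F p X) (differential F p Y) = gM p X Y}.

Definition almost_h_semi_slant_basis (gM : riemannian_metric M)
    (E : M -> {vspace 'End('rV[R]_m)}) (F : M -> N) (U : set M)
    (J : 'Z_3 -> M -> 'End('rV[R]_m)) (theta : 'Z_3 -> R) : Prop :=
  quaternionic_basis gM E U J /\
  forall a, exists D1 : M -> {vspace 'rV[R]_m},
    let D2 q := (lker (differential F q) :&: orthov (gM q) (D1 q))%VS in
    [/\ distribution U D1,
        forall q, U q -> (D1 q <= lker (differential F q))%VS,
        forall q, U q -> (J a q @: D1 q)%VS = D1 q,
        forall q X, U q -> X \in D2 q -> X != 0 ->
          angle (gM q) (J a q X) (D2 q) = theta a
      & (forall q, U q -> D2 q = 0%VS) -> theta a = 0].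

Definition almost_h_semi_slant_map (gM : riemannian_metric M)
    (gN : riemannian_metric N)
    (E : M -> {vspace 'End('rV[R]_m)}) (F : M -> N) : Prop :=
  riemannian_map gM gN F /\
  forall p, exists U J theta,
    open_nbhs p U /\ almost_h_semi_slant_basis gM E F U J theta.

End Maps.

(* Main.v *)
Require Import Defs.
From HB Require Import structures.
From mathcomp Require Import all_boot all_order all_algebra.
From mathcomp Require Import sesquilinear.
From mathcomp Require Import all_classical all_reals all_analysis.
From mathcomp Require Import ring lra zify.

Set Implicit Arguments.
Unset Strict Implicit.
Unset Printing Implicit Defensive.
Import Order.TTheory GRing.Theory Num.Theory numFieldNormedType.Exports.
Local Open Scope classical_set_scope.
Local Open Scope ring_scope.

(** Write d(p) for the dimension of the kernel of the differential of F at p.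
The fiber through p has dimension d(p), and three facts about d make up the
proof.

d is even.  At p choose a member R of the slant basis whose angle is not pi/2.
The kernel of F_* is the orthogonal sum of D1 and D2, and on both summands the
form (X, Y) |-> g(RX, Y) is skew, because R is an isometry with R^2 = -1.  It is
nondegenerate on D1, which R preserves, and nondegenerate on D2, because a
nonzero X in D2 with RX orthogonal to D2 would make the angle pi/2.  A space
with a nondegenerate skew form has even dimension (even_dim_skew_form,
even_dim_semi_slant_kernel).

d is locally constant.  In coordinates let J be the Jacobian matrix of F and
G, H the Gram matrices of the two metrics.  The rank of J is lower
semicontinuous.  For a Riemannian map the form G - J H J^T, the metric of M
minus the pullback of the metric of N, vanishes on the orthogonal complement of
the kernel and is the metric on the kernel; so its rank is d, and that rank is
lower semicontinuous too.  The two ranks add up to the dimension of M, hence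
neither of them can jump (rank_isometry, rank_locally_constant).

The fibers are submanifolds.  Since the rank of F is locally constant, this is
the constant rank theorem (constant_rank_fiber).  Near p, coordinates in which
the fiber is a plane are obtained by completing rank-many components of F with
linear functions; the inverse function theorem (inverse_function) says that
these are coordinates, and the constancy of the rank says that the other
components of F are determined by the chosen ones.  The inverse function theorem
itself comes from the fixed point theorem for contractions, and the smoothness
of the inverse from the fact that its derivative is a rational function of the
Jacobian matrix at the inverse image.  Composing these coordinates with a chart
of M gives the adapted chart (compatible_chart, fiber_submanifold). *)

(** * Differentials *)

Lemma open_preimage_setI (T U : topologicalType) (f : T -> U) (A : set T) (B : set U) :
  open A -> (forall x, A x -> {for x, continuous f}) -> open B ->
  open (A `&` f @^-1` B).
Proof.
move=> oA cf oB; rewrite openE => x [Ax Bfx].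
have nA : nbhs x A by exact: open_nbhs_nbhs.
have nB : nbhs x (f @^-1` B) by apply: cf => //; exact: open_nbhs_nbhs.
exact: filterI nA nB.
Qed.

Lemma near_eq_diff (R : realType) (V W : normedModType R) (f g : V -> W) (x : V) :
  {near x, f =1 g} -> differentiable f x -> differentiable g x.
Proof.
move=> fg df.
have dgE : g \o shift x = cst (g x) + 'd f x +o_ 0 id.
  apply/eqaddoE; apply/eqaddoP => _/posnumP[e].
  have /diff_locally/eqaddoP/(_ e%:num ltac:(done)) := df.
  have : \forall y \near 0, f (y + x) = g (y + x).
    by move: fg; rewrite (near_shift 0 x) subr0.
  by apply: filterS2 => y fgy; rewrite !fctE /= -fgy -(nbhs_singleton fg).
apply/diff_locallyP; rewrite (diff_unique (diff_continuous df) dgE).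
by split; first exact: diff_continuous.
Qed.

Lemma continuous_normP (R : realType) (V W : normedModType R) (f : V -> W) x :
  {for x, continuous f} <->
  forall e, 0 < e -> \forall y \near x, `|f x - f y| < e.
Proof. exact: cvgrPdist_lt. Qed.

Lemma diff_remainder_le (R : realType) (V W : normedModType R) (f : V -> W) x :
  differentiable f x -> forall e, 0 < e ->
  \forall y \near x, `|f y - f x - 'd f x (y - x)| <= e * `|y - x|.
Proof.
move=> df e e0; have /diff_locally/eqaddoP/(_ e e0) H := df.
rewrite (near_shift 0 x); apply: filterS H => h.
by rewrite !fctE /= subr0 addrK opprD addrA.
Qed.

Lemma remainder_le_diff (R : realType) (V W : normedModType R) (f : V -> W)
    (l : {linear V -> W}) x : continuous l ->
  (forall e, 0 < e ->
    \forall y \near x, `|f y - f x - l (y - x)| <= e * `|y - x|) ->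
  differentiable f x /\ 'd f x = l :> (V -> W).
Proof.
move=> cl H; have fE : f \o shift x = cst (f x) + l +o_ 0 id.
  apply/eqaddoE; apply/eqaddoP => e e0.
  move: (H e e0); rewrite (near_shift 0 x) => H'; apply: filterS H' => h /=.
  by rewrite !fctE /= subr0 addrK opprD addrA.
have dfE := diff_unique cl fE; split=> //.
by apply/diff_locallyP; rewrite dfE.
Qed.

Lemma diff_linear_comp (R : realType) (V W W' : normedModType R) (f : V -> W)
    (l : {linear W -> W'}) x : continuous l -> differentiable f x ->
  differentiable (fun y => l (f y)) x /\
  forall v, 'd (fun y => l (f y)) x v = l ('d f x v).
Proof.
move=> cl df; have dl : differentiable (l : W -> W') (f x).
  exact: linear_differentiable.
split; first exact: differentiable_comp df dl.
move=> v; rewrite (congr1 (fun k => k v) (diff_comp df dl)) /=.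
by rewrite diff_lin.
Qed.

(** The map y |-> l (f y) - y measures how far l \o f is from the identity; it is
a contraction where l nearly inverts the differential of f. *)
Lemma diff_linear_compB (R : realType) (V W : normedModType R) (f : V -> W)
    (l : {linear W -> V}) x : continuous l -> differentiable f x ->
  differentiable (fun y => l (f y) - y) x /\
  forall v, 'd (fun y => l (f y) - y) x v = l ('d f x v) - v.
Proof.
move=> cl df; have [dlf dlfE] := diff_linear_comp cl df.
have [did didE] := is_diff_id x.
split; first exact: differentiableB dlf did.
move=> v; rewrite (congr1 (fun k => k v) (diffB dlf did)) /= dlfE.
by rewrite didE.
Qed.

Lemma diff_affine_sum (R : realType) (V W V' : normedModType R) (f : V -> W)
    (l1 : {linear V -> V'}) (l2 : {linear W -> V'}) (a : V) (b : W) x :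
  continuous l1 -> continuous l2 -> differentiable f x ->
  differentiable (fun y => l1 (y - a) + l2 (f y - b)) x /\
  forall v, 'd (fun y => l1 (y - a) + l2 (f y - b)) x v = l1 v + l2 ('d f x v).
Proof.
move=> c1 c2 df.
have [dl dlE] := diff_linear_comp c2 df.
have [d1 d1E] : differentiable (l1 : V -> V') x /\ forall v, 'd (l1 : V -> V') x v = l1 v.
  by split; [exact: linear_differentiable|move=> v; rewrite diff_lin].
have dlc : differentiable (cst (- l1 a - l2 b)) x by exact: differentiable_cst.
have E : (fun y => l1 (y - a) + l2 (f y - b)) =
    (l1 : V -> V') + (fun y => l2 (f y)) + cst (- l1 a - l2 b).
  by apply/funext => y; rewrite !fctE !linearB addrACA.
rewrite E; split; first exact: differentiableD (differentiableD d1 dl) dlc.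
move=> v; apply: etrans (congr1 (fun k => k v) (diffD (differentiableD d1 dl) dlc)) _.
rewrite /= [X in _ + X](congr1 (fun k => k v) (diff_cst _ _)) addr0.
apply: etrans (congr1 (fun k => k v) (diffD d1 dl)) _.
by rewrite /= d1E dlE.
Qed.

Lemma near_eq_diff_comp (R : realType) (V W W' : normedModType R) (f : V -> W)
    (g : W -> W') (h : V -> W') x :
  differentiable f x -> differentiable g (f x) -> {near x, g \o f =1 h} ->
  differentiable h x /\ forall v, 'd h x v = 'd g (f x) ('d f x v).
Proof.
move=> df dg gfh; have dgf : differentiable (g \o f) x by exact: differentiable_comp.
have dh := near_eq_diff gfh dgf; split=> // v.
transitivity ('d (g \o f) x v); last first.
  by rewrite (congr1 (fun k => k v) (diff_comp df dg)).
by rewrite -[LHS]deriveE// -[RHS]deriveE// (near_eq_derive _ gfh).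
Qed.

Lemma linear_rV_continuous (R : realType) n (W : normedModType R)
  (f : {linear 'rV[R]_n -> W}) : continuous f.
Proof.
have fE : (f : _ -> _) = \sum_(i < n) (fun v : 'rV[R]_n => v 0 i *: f (delta_mx 0 i)).
  apply/funext => v; rewrite fct_sumE [in LHS](row_sum_delta v) linear_sum.
  by apply: eq_bigr => i _; rewrite linearZ.
move=> v; apply: differentiable_continuous; rewrite fE.
apply: differentiable_sum => i; apply: differentiableZl.
exact: differentiable_coord.
Qed.

(** The basis expansion f = \sum_i f_i e_i reduces vector-valued functions to
scalar ones; the same reduction is used for the classes Ck below. *)
Lemma differentiable_rV (R : realType) (V : normedModType R) n (f : V -> 'rV[R]_n) x :
  (forall i, differentiable ((fun y => f y 0 i) : V -> R) x) -> differentiable f x.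
Proof.
move=> df; rewrite (_ : f = \sum_(i < n) (fun y => f y 0 i *: delta_mx 0 i)).
  by apply: differentiable_sum => i; exact: differentiableZl.
by apply/funext => y; rewrite fct_sumE -row_sum_delta.
Qed.

Lemma differentiable_coordE (R : realType) (V : normedModType R) n (f : V -> 'rV[R]_n) x i :
  differentiable f x -> differentiable ((fun y => f y 0 i) : V -> R) x.
Proof.
move=> df; exact: (differentiable_comp df (differentiable_coord (f x) 0 i)).
Qed.

Lemma derive_coord (R : realType) (V : normedModType R) n (f : V -> 'rV[R]_n) x v i :
  differentiable f x -> 'D_v f x 0 i = 'D_v ((fun y => f y 0 i) : V -> R) x.
Proof. by move=> df; rewrite derive_mx ?mxE//; exact: diff_derivable. Qed.

Lemma derive_comp_rV (R : realType) (V W : normedModType R) n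
    (f : V -> 'rV[R]_n) (g : 'rV[R]_n -> W) x v :
  differentiable f x -> differentiable g (f x) ->
  'D_v (g \o f) x = \sum_i 'D_v f x 0 i *: 'D_(delta_mx 0 i) g (f x).
Proof.
move=> df dg; rewrite deriveE; last exact: differentiable_comp.
rewrite diff_comp//= -(deriveE _ df); set u := 'D_v f x.
rewrite (_ : 'd g (f x) u = 'd g (f x) (\sum_i u 0 i *: delta_mx 0 i)).
  by rewrite linear_sum; apply: eq_bigr => i _; rewrite linearZ deriveE.
by rewrite -row_sum_delta.
Qed.

Lemma jacobianE (R : realType) n p (f : 'rV[R]_n -> 'rV[R]_p) y i j :
  differentiable f y -> 'J f y i j = 'D_(delta_mx 0 i) f y 0 j.
Proof. by move=> df; rewrite mxE deriveE. Qed.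

Lemma diffE_jacobian (R : realType) n p (f : 'rV[R]_n -> 'rV[R]_p) y v :
  'd f y v = v *m 'J f y.
Proof. by rewrite mul_rV_lin1. Qed.

Lemma jacobian_comp (R : realType) n p q (f : 'rV[R]_n -> 'rV[R]_p)
    (g : 'rV[R]_p -> 'rV[R]_q) y :
  differentiable f y -> differentiable g (f y) ->
  'J (g \o f) y = 'J f y *m 'J g (f y).
Proof.
move=> df dg; apply/row_matrixP => i; rewrite row_mul !rowE -!diffE_jacobian.
by rewrite diff_comp//= diffE_jacobian.
Qed.

Lemma rV_norm_le (R : realType) n (v : 'rV[R]_n) (C : R) :
  0 <= C -> (forall i, `|v 0 i| <= C) -> `|v| <= C.
Proof.
move=> C0 vC; rewrite /Num.Def.normr/= mx_normrE (bigmax_le _ C0)//= => -[i0 i] _.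
by rewrite (ord1 i0).
Qed.

Lemma norm_coord_le (R : realType) n (v : 'rV[R]_n) i : `|v 0 i| <= `|v|.
Proof.
rewrite [leRHS]/Num.Def.normr/= mx_normrE.
exact: (le_bigmax _ (fun ij : 'I_1 * 'I_n => `|v ij.1 ij.2|) (0, i)).
Qed.

Lemma ball_segment (R : realType) (V : normedModType R) (a x h : V) (r t : R) :
  0 <= t <= 1 -> ball a r x -> ball a r (x + h) -> ball a r (x + t *: h).
Proof.
rewrite -ball_normE /= => /andP[t0 t1] ax axh.
have -> : a - (x + t *: h) = (1 - t) *: (a - x) + t *: (a - (x + h)).
  by rewrite (opprD x h) (addrA a) (scalerBr t) scalerBl scale1r addrA subrK opprD addrA.
apply: le_lt_trans (ler_normD _ _) _; rewrite !normrZ !ger0_norm ?subr_ge0//.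
have [->|t0'] := eqVneq t 0; first by rewrite subr0 mul1r mul0r addr0.
have tp : 0 < t by rewrite lt_neqAle eq_sym t0'.
apply: (@lt_le_trans _ _ ((1 - t) * r + t * r)); last by rewrite -mulrDl subrK mul1r.
by apply: ler_ltD; [rewrite ler_wpM2l ?subr_ge0// ltW|rewrite ltr_pM2l].
Qed.

(** Mean value inequality.  For the sup norm it follows coordinate by coordinate
from the mean value theorem for real functions on [0, 1]. *)
Lemma le_diff_segment (R : realType) (V : normedModType R) n (f : V -> 'rV[R]_n)
    (x h : V) (C : R) :
  (forall t : R, 0 <= t <= 1 -> differentiable f (x + t *: h) /\
     `|'d f (x + t *: h) h| <= C) -> `|f (x + h) - f x| <= C.
Proof.
move=> H; have C0 : 0 <= C.
  by apply: le_trans (H 0 _).2 => //; rewrite lexx ler01.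
apply: rV_norm_le => // i; rewrite !mxE.
pose l (t : R) := x + t *: h.
have dl t : is_diff t l ( *:%R^~ h).
  rewrite (_ : l = cst x + ( *:%R^~ h)); last by apply/funext => ?; rewrite fctE.
  by apply: is_diff_eq; rewrite add0r.
have ldiff (t : R) : differentiable l t by case: (dl t).
have D (t : R) : 0 <= t <= 1 ->
    is_derive t (1 : R) (fun t => f (l t) 0 i : R) ('d f (l t) h 0 i).
  move=> /H[df _]; have dfl : differentiable (f \o l) t.
    by apply: differentiable_comp; [exact: ldiff|].
  apply: DeriveDef.
    exact/diff_derivable/(differentiable_coordE i dfl).
  rewrite -(derive_coord _ _ dfl) deriveE// diff_comp//=.
    by rewrite diff_val scale1r.
have [||t t01] := @MVT_segment R (fun t => f (l t) 0 i) (fun t => 'd f (l t) h 0 i) 0 1 ler01.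
- by move=> t /[!in_itv]/= /andP[/ltW t0 /ltW t1]; apply: D; rewrite t0.
- apply: derivable_within_continuous => t; rewrite in_itv /= => t01.
  by case: (D t t01).
rewrite /l scale1r scale0r addr0 subr0 mulr1 => ->.
apply: le_trans (norm_coord_le _ _) (H t _).2.
by move: t01; rewrite in_itv.
Qed.

Lemma norm_mulmx_le (R : realType) n p (E : 'M[R]_(n, p)) (e : R) (v : 'rV_n) :
  0 <= e -> (forall i j, `|E i j| <= e) -> `|v *m E| <= n%:R * e * `|v|.
Proof.
move=> e0 Ee; have b0 : 0 <= n%:R * e * `|v| by rewrite !mulr_ge0.
apply: rV_norm_le => // j; rewrite mxE; apply: le_trans (ler_norm_sum _ _ _) _.
rewrite -mulrA mulr_natl.
have <- : \sum_(i < n) e * `|v| = e * `|v| *+ n by rewrite sumr_const card_ord.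
apply: ler_sum => i _; rewrite normrM mulrC ler_pM//; exact: norm_coord_le.
Qed.

(** * Calculus of the classes Ck *)

(* Scalar functions take values in R and not in its copy R^o, so that sums and
   products in the statements are those of R. *)
Local Notation CkR k A f := (@Ck (_ : realType) _ (_ : realType) k A f).

Section CkCalculus.
Variables (R : realType) (V : normedModType R).
Implicit Types (A B : set V).

Lemma Ck_sub (W : normedModType R) k A B (f : V -> W) :
  A `<=` B -> Ck k B f -> Ck k A f.
Proof.
move=> AB; elim: k f => [|k IH] f /=; first by move=> H x /AB /H.
by case=> df Df; split=> [x /AB /df //|v]; exact: IH.
Qed.

Lemma Ck_continuous (W : normedModType R) k A (f : V -> W) :
  Ck k A f -> forall x, A x -> {for x, continuous f}.
Proof.
by case: k => [//|k] [df _] x Ax; apply/differentiable_continuous/df.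
Qed.

Lemma Ck_succW (W : normedModType R) k A (f : V -> W) :
  Ck k.+1 A f -> Ck k A f.
Proof.
elim: k f => [|k IH] f; first by move/Ck_continuous.
by case=> df Df; split=> // v; exact/IH/Df.
Qed.

Lemma eq_Ck (W : normedModType R) k A (f g : V -> W) : open A ->
  (forall x, A x -> f x = g x) -> Ck k A f -> Ck k A g.
Proof.
move=> oA; elim: k f g => [|k IH] f g fg.
  move=> cf x Ax; have fgx : {near x, f =1 g}.
    by apply: filterS fg _; exact: open_nbhs_nbhs.
  rewrite /prop_for /continuous_at -fg//.
  exact: cvg_trans (near_eq_cvg fgx) (cf x Ax).
have fgx x : A x -> {near x, f =1 g}.
  by move=> Ax; apply: filterS fg _; exact: open_nbhs_nbhs.
case=> df Df; split=> [x Ax|v]; first exact: near_eq_diff (fgx x Ax) (df x Ax).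
by apply: IH (Df v) => x Ax; apply: near_eq_derive; exact: fgx.
Qed.

Lemma Ck_cst (W : normedModType R) k A (c : W) : Ck k A (cst c).
Proof.
elim: k c => [|k IH] c /=; first by move=> x _; exact: cst_continuous.
split=> [x _|v]; first exact: differentiable_cst.
have -> : 'D_v (cst c) = cst 0 :> (V -> W).
  by apply/funext => x; exact: derive_cst.
exact: IH.
Qed.

Lemma CkD (W : normedModType R) k A (f g : V -> W) : open A ->
  Ck k A f -> Ck k A g -> Ck k A (fun x => f x + g x).
Proof.
move=> oA; elim: k f g => [|k IH] f g /= Cf Cg.
  by move=> x Ax; apply: continuousD; [exact: Cf|exact: Cg].
case: Cf Cg => df Df [dg Dg]; split=> [x Ax|v].
  by apply: differentiableD; [exact: df|exact: dg].
apply: (@eq_Ck _ _ _ ('D_v f + 'D_v g)) (IH _ _ (Df v) (Dg v)) => // x Ax.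
by rewrite deriveD//; apply: diff_derivable; [exact: df|exact: dg].
Qed.

Lemma CkM k A (f g : V -> R) : open A ->
  CkR k A f -> CkR k A g -> CkR k A (fun x => f x * g x).
Proof.
move=> oA; elim: k f g => [|k IH] f g Cf Cg.
  by move=> x Ax; apply: (@continuousM R); [exact: Cf|exact: Cg].
move: (Cf) (Cg) => /= [df Df] [dg Dg]; split=> [x Ax|v].
  by apply: (@differentiableM R); [exact: df|exact: dg].
apply: (@eq_Ck _ _ _ (fun x => f x * 'D_v (g : V -> R) x + g x * 'D_v (f : V -> R) x)) => //.
  by move=> x Ax; rewrite deriveM//; apply: diff_derivable; [exact: df|exact: dg].
by apply: CkD; rewrite //; apply: IH => //; exact: Ck_succW.
Qed.

Lemma Ck_sum k A (I : Type) (r : seq I) (P : pred I) (F : I -> V -> R) :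
  open A -> (forall i, P i -> CkR k A (F i)) ->
  CkR k A (fun x => \sum_(i <- r | P i) F i x).
Proof.
move=> oA CF; elim: r => [|i r IH].
  by rewrite (_ : (fun _ => _) = cst 0)//; [exact: Ck_cst|apply/funext=> x; rewrite big_nil].
case Pi: (P i); last first.
  by under eq_fun do rewrite big_cons Pi.
under eq_fun do rewrite big_cons Pi.
by apply: CkD => //; exact: CF.
Qed.

Lemma Ck_prod k A (I : Type) (r : seq I) (P : pred I) (F : I -> V -> R) :
  open A -> (forall i, P i -> CkR k A (F i)) ->
  CkR k A (fun x => \prod_(i <- r | P i) F i x).
Proof.
move=> oA CF; elim: r => [|i r IH].
  rewrite (_ : (fun _ => _) = cst (1 ))//; first exact: Ck_cst.
  by apply/funext=> x; rewrite big_nil.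
case Pi: (P i); last first.
  by under eq_fun do rewrite big_cons Pi.
under eq_fun do rewrite big_cons Pi.
by apply: CkM => //; exact: CF.
Qed.

Lemma CkV k A (f : V -> R) : open A -> (forall x, A x -> f x != 0) ->
  CkR k A f -> CkR k A (fun x => (f x)^-1).
Proof.
move=> oA f0; elim: k f f0 => [|k IH] f f0 Cf.
  by move=> x Ax; apply: (@continuousV R); [exact: f0|exact: Cf].
move: (Cf) => /= [df Df]; split=> [x Ax|v].
  by apply: (@differentiableV R); [exact: df|exact: f0].
pose g : V -> R := fun x => (f x)^-1.
apply: (@eq_Ck _ _ _ (fun x => -1 * (g x * g x) * 'D_v (f : V -> R) x)) => //.
  move=> x Ax; rewrite (deriveV (f0 x Ax)); last exact/diff_derivable/df.
  rewrite /= /g expr2 invfM mulN1r; exact: erefl.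
have Cg : Ck k A g by apply: IH => //; exact: Ck_succW.
by apply: CkM => //; apply: CkM => //; [exact: Ck_cst|exact: CkM].
Qed.

Lemma Ck_det k A n (F : V -> 'M[R]_n) : open A ->
  (forall i j, CkR k A (fun x => F x i j)) ->
  CkR k A (fun x => \det (F x)).
Proof.
move=> oA CF; apply: Ck_sum => // s _.
apply: (CkM oA (Ck_cst _ _ _)).
by apply: Ck_prod => // i _; exact: CF.
Qed.

(** By Cramer's rule the entries of the inverse are quotients of determinants;
this is what makes the inverse of a diffeomorphism smooth. *)
Lemma Ck_invmx k A n (F : V -> 'M[R]_n) : open A ->
  (forall x, A x -> F x \in unitmx) ->
  (forall i j, CkR k A (fun x => F x i j)) ->
  forall i j, CkR k A (fun x => invmx (F x) i j).
Proof.
move=> oA uF CF i j.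
apply: (@eq_Ck _ _ _ ((fun x => (\det (F x))^-1) * (fun x => (\adj (F x)) i j))) => //.
  by move=> x Ax; rewrite /invmx uF// mxE.
apply: CkM => //.
  apply: CkV => //; last exact: Ck_det.
  by move=> x /uF; rewrite unitmxE unitfE.
under eq_fun do rewrite mxE.
apply: (CkM oA (Ck_cst _ _ _)).
apply: Ck_det => // a b; under eq_fun do rewrite !mxE; exact: CF.
Qed.

Lemma Ck_coord n k A (f : V -> 'rV[R]_n) : open A ->
  Ck k A f -> forall i, CkR k A (fun y => f y 0 i).
Proof.
move=> oA; elim: k f => [|k IH] f Cf i.
  move=> x Ax; apply: (@continuous_comp _ _ _ f (fun M => M 0 i)); [exact: Cf|exact: coord_continuous].
case: Cf => df Df; split=> [x Ax|v]; first by apply: differentiable_coordE; exact: df.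
apply: (eq_Ck oA _ (IH _ (Df v) i)) => x /df ?; exact: derive_coord.
Qed.

Lemma Ck_rV n k A (f : V -> 'rV[R]_n) : open A ->
  (forall i, CkR k A (fun y => f y 0 i)) -> Ck k A f.
Proof.
move=> oA; elim: k f => [|k IH] f Cf.
  move=> x Ax; apply/cvgrPdist_le => e e0; near=> y.
  rewrite /Num.Def.normr/= mx_normrE (bigmax_le _ (ltW e0))//= => -[i0 i] _.
  rewrite !mxE /= ord1; move: i; near: y; apply: filter_forall => i.
  by have /cvgrPdist_le/(_ _ e0) := Cf i x Ax.
have df x : A x -> differentiable f x.
  by move=> Ax; apply: differentiable_rV => i; apply: (Cf i).1.
split=> // v; apply: IH => i.
apply: eq_Ck ((Cf i).2 v) => // x Ax; exact/esym/derive_coord/df.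
Unshelve. all: by end_near. Qed.

End CkCalculus.

(** By induction on k: the partial derivatives in the chain rule
D_v (g \o f) = \sum_i (D_v f)_i (D_i g \o f) are of class C^k by hypothesis,
and their composites with f by induction. *)
Lemma Ck_comp (R : realType) (V : normedModType R) n m k (A : set V) (B : set 'rV[R]_n)
    (f : V -> 'rV[R]_n) (g : 'rV[R]_n -> 'rV[R]_m) : open A -> open B ->
  (forall x, A x -> B (f x)) -> Ck k A f -> Ck k B g -> Ck k A (g \o f).
Proof.
move=> oA oB AB; elim: k f g AB => [|k IH] f g AB Cf Cg.
  by move=> x Ax; apply: continuous_comp; [exact: Cf|exact/Cg/AB].
have [[df Df] [dg Dg]] := (Cf, Cg); split=> [x Ax|v].
  by apply: differentiable_comp; [exact: df|exact/dg/AB].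
apply: Ck_rV => // j.
apply: (@eq_Ck _ _ _ _ _ (fun x => \sum_i 'D_v f x 0 i * 'D_(delta_mx 0 i) g (f x) 0 j)) => //.
  move=> x Ax; rewrite derive_comp_rV//; [|exact: df|exact/dg/AB].
  by rewrite summxE; apply: eq_bigr => i _; rewrite mxE.
apply: Ck_sum => // i _; apply: CkM => //; first exact: (Ck_coord oA (Df v)).
by apply: (Ck_coord oA (IH _ _ AB _ (Dg _))); exact: Ck_succW.
Qed.

Lemma Ck_id (R : realType) (V : normedModType R) k (A : set V) : Ck k A id.
Proof.
case: k => [|k]; first by move=> x _; exact: cvg_id.
split=> [x _|v]; first exact: ex_diff.
by rewrite (_ : 'D_v id = cst v); [exact: Ck_cst|apply/funext=> x; exact: derive_id].
Qed.

Lemma Ck_mulmxr (R : realType) (V : normedModType R) n p (Q : 'M[R]_(n, p)) k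
    (A : set V) (f : V -> 'rV_n) :
  open A -> Ck k A f -> Ck k A (fun x => f x *m Q).
Proof.
move=> oA Cf; apply: Ck_rV => // j.
under eq_fun do rewrite mxE.
apply: Ck_sum => // i _; apply: CkM => //; last exact: Ck_cst.
exact: (Ck_coord oA Cf).
Qed.

Lemma Ck_jacobian (R : realType) n p k (A : set 'rV[R]_n)
    (f : 'rV[R]_n -> 'rV[R]_p) : open A -> Ck k.+1 A f ->
  forall i j, CkR k A (fun y => 'J f y i j).
Proof.
move=> oA [df Df] i j.
by apply: (eq_Ck oA _ (Ck_coord oA (Df (delta_mx 0 i)) j)) => y /df ?; rewrite jacobianE.
Qed.

Lemma smooth_differentiable (R : realType) (V W : normedModType R) (A : set V) (f : V -> W) x :
  smooth_on A f -> A x -> differentiable f x.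
Proof. by move=> /(_ 1)[df _]; exact: df. Qed.

(** * Inverse function theorem *)

Section NearIdentity.
Variables (R : realType) (n : nat) (A : set 'rV[R]_n) (F : 'rV[R]_n -> 'rV[R]_n).
Hypothesis F_id : forall x y, A x -> A y ->
  `|(F x - F y) - (x - y)| <= 2^-1 * `|x - y|.

(** A map that differs from the identity by a 1/2-contraction spreads points
apart by at least half of their distance, hence is injective. *)
Lemma near_id_expand x y : A x -> A y -> `|x - y| <= 2 * `|F x - F y|.
Proof.
move=> Ax Ay; have := F_id Ax Ay; have := lerB_dist (x - y) (F x - F y).
rewrite (distrC (x - y)); set u := `|_|; set v := `|_|; set w := `|_|.
by move=> *; lra.
Qed.

(** Solutions of F x = y are the fixed points of x |-> x - F x + y, a
contraction of the closed ball of radius r into itself when y is within r/2 of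
F a. *)
Lemma near_id_surj a (r : R) : 0 < r ->
  (forall x, `|a - x| <= r -> A x) ->
  forall y, `|F a - y| <= r / 2 -> exists2 x, `|a - x| <= r & F x = y.
Proof.
move=> r0 rA y ya.
pose U : set 'rV[R]_n := closed_ball_ Num.norm a r.
pose T x := x - F x + y.
have Aa : A a by apply: rA; rewrite subrr normr0 ltW.
have TU : set_fun U U T.
  move=> x /= ax; rewrite /U /closed_ball_ /= /T.
  have -> : a - (x - F x + y) = (F x - F a - (x - a)) + (F a - y).
    by apply/rowP => i; rewrite !mxE; ring.
  apply: le_trans (ler_normD _ _) _.
  apply: le_trans (lerD (F_id (rA _ ax) Aa) ya) _; rewrite (distrC x).
  have axr : `|a - x| <= r := ax; move: axr; set u := `|a - x| => axr; lra.
pose TF : {fun U >-> U} := HB.pack T (isFun.Build _ _ U U T TU).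
pose X : completeNormedModType R := HB.pack 'rV[R]_n.
have [|||x Ux xT] := @banach_fixed_point R X U TF.
- exists (2^-1 : R)%:nng; split=> /=; first by rewrite invf_lt1// ltr1n.
  move=> [x z] [/= Ux Uz]; rewrite /T.
  have -> : x - F x + y - (z - F z + y) = - ((F x - F z) - (x - z)).
    by apply/rowP => i; rewrite !mxE; ring.
  by rewrite normrN; apply: F_id; exact: rA.
- by rewrite /U -closed_ballE//; exact: closed_ball_closed.
- by exists a; rewrite /U /= /closed_ball_ /= subrr normr0 ltW.
exists x => //; move: xT; rewrite /= /T => xT.
apply/eqP; rewrite eq_sym -subr_eq0; apply/eqP.
have : x - F x + y - x = 0 by rewrite -xT subrr.
by move=> <-; apply/rowP => i; rewrite !mxE; ring.
Qed.

End NearIdentity.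

Section InverseFunction.
Variables (R : realType) (n : nat) (f : 'rV[R]_n -> 'rV[R]_n).

(** By continuity of the Jacobian, multiplying by the inverse of its value at a
normalizes it to be close to the identity near a. *)
Lemma jacobian_near_id (A : set 'rV[R]_n) a : open A -> A a -> smooth_on A f ->
  'J f a \in unitmx -> exists2 r : R, 0 < r & ball a r `<=` A /\
  forall y (v : 'rV[R]_n), ball a r y -> `|v *m 'J f y *m invmx ('J f a) - v| <= 2^-1 * `|v|.
Proof.
move=> oA Aa sf uJ; set L := invmx _.
pose E y := 'J f y *m L - 1%:M.
have Ea : E a = 0 by rewrite /E mulmxV// subrr.
have cE i j : {for a, continuous (fun y => E y i j)}.
  apply: (@Ck_continuous R _ R 0 A); last exact: Aa.
  have -> : (fun y => E y i j) =
      (fun y => \sum_k 'J f y i k * L k j + - (1%:M : 'M[R]_n) i j).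
    by apply/funext => y; rewrite /E mxE [in LHS]mxE [X in _ + X]mxE.
  apply: CkD => //; last exact: Ck_cst.
  apply: Ck_sum => // k _; apply: CkM => //; last exact: Ck_cst.
  exact: (Ck_jacobian oA (sf 1)).
(* An n by n matrix with entries below e has operator norm at most n e. *)
pose e : R := (2 * n.+1%:R)^-1.
have e0 : 0 < e by rewrite invr_gt0 mulr_gt0.
have Esmall : \forall y \near a, forall ij : 'I_n * 'I_n, `|E y ij.1 ij.2| <= e.
  apply: (@filter_forall _ _ _ (nbhs a)) => -[i j] /=; have /cvgrPdist_le/(_ _ e0) := cE i j.
  by move=> H; apply: filterS H => y; rewrite Ea mxE sub0r normrN.
have : \forall y \near a, A y by exact: open_nbhs_nbhs.
move=> /(filterI Esmall)/nbhs_ballP[r /= r0 rP]; exists r => //; split.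
  by move=> y /rP[].
move=> y v /rP[/= Ey _].
have -> : v *m 'J f y *m L - v = v *m E y by rewrite /E mulmxBr mulmx1 mulmxA.
apply: le_trans (norm_mulmx_le _ (ltW e0) (fun i j => Ey (i, j))) _.
rewrite ler_wpM2r// /e invfM mulrCA ger_pMr ?invr_gt0// ler_pdivrMr//.
by rewrite mul1r ler_nat.
Qed.

(** Mean value inequality for y |-> f y L - y, whose differential is a
1/2-contraction on the ball. *)
Lemma ball_near_id (V : set 'rV[R]_n) a r L : V = ball a r ->
  (forall x, V x -> differentiable f x) ->
  (forall y (v : 'rV_n), V y -> `|v *m 'J f y *m L - v| <= 2^-1 * `|v|) ->
  forall x y, V x -> V y ->
  `|(f x *m L - f y *m L) - (x - y)| <= 2^-1 * `|x - y|.
Proof.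
move=> VE dfV H x y Vx Vy.
pose G z := f z *m L - z.
have -> : f x *m L - f y *m L - (x - y) = G (y + (x - y)) - G y.
  rewrite /G subrKC; move: (f x *m L) (f y *m L) => u w.
  by apply/rowP => i; rewrite !mxE; ring.
apply: le_diff_segment => t t01.
have Vz : V (y + t *: (x - y)) by rewrite VE; apply: ball_segment; rewrite // -?VE// subrKC.
have cL := @linear_rV_continuous R n 'rV[R]_n (mulmxr L).
have [dG dGE] := diff_linear_compB cL (dfV _ Vz).
split; first exact: dG.
by move: (H _ (x - y) Vz); rewrite -diffE_jacobian -[_ *m L]/(mulmxr L _) -dGE.
Qed.

(** The normalized map f L is close to the identity near a, so f is injective and
open there with a Lipschitz inverse g.  The Lipschitz bound turns the remainder
of f into one for g, whence dg = (J f \o g)^-1; this formula lifts the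
regularity of g from C^k to C^k+1. *)
Theorem inverse_function (A : set 'rV[R]_n) a : open A -> A a -> smooth_on A f ->
  'J f a \in unitmx ->
  exists V g, [/\ open_nbhs a V, V `<=` A, open (f @` V), smooth_on (f @` V) g
    & forall x, V x -> g (f x) = x].
Proof.
move=> oA Aa sf uJ.
have [r r0 [VA VJ]] := jacobian_near_id oA Aa sf uJ.
set L := invmx _ in VJ; set V := ball a r in VA VJ.
have uL : L \in unitmx by rewrite unitmx_inv.
have dfV x : V x -> differentiable f x by move=> /VA; exact: (sf 1).1.
have Fid := ball_near_id (erefl V) dfV VJ.
have Va : V a by exact: ballxx.
have oV : open V by exact: ball_open.
have expand x y : V x -> V y -> `|x - y| <= 2 * `|f x *m L - f y *m L|.
  exact: near_id_expand Fid x y.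
have cL := @linear_rV_continuous R n 'rV[R]_n (mulmxr L).
have [K K0 LK] := linear_lipschitz cL.
have lip x y : V x -> V y -> `|x - y| <= (2 * K) * `|f x - f y|.
  move=> Vx Vy; apply: le_trans (expand _ _ Vx Vy) _.
  by rewrite -mulrA ler_wpM2l// -mulmxBl; exact: LK.
have oW : open (f @` V).
  rewrite openE => _ [x Vx <-].
  have /nbhs_closedballP[s sV] : nbhs x V by apply: open_nbhs_nbhs.
  have : \forall z \near f x, `|f x *m L - z *m L| <= s%:num / 2.
    have /cvgrPdist_le := cL (f x); apply; exact: divr_gt0.
  apply: filterS => z zs.
  have sV' y : `|x - y| <= s%:num -> V y.
    by move=> xy; apply: sV; rewrite closed_ballE.
  have [x' x'V x'z] := near_id_surj (F := fun x => f x *m L) Fid (gt0 s) sV' zs.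
  exists x'; first exact: sV'.
  by rewrite -[LHS](mulmxK uL) x'z mulmxK.
pose g y := xget a [set x | V x /\ f x = y].
have gP y : (f @` V) y -> V (g y) /\ f (g y) = y.
  by move=> [x Vx fx]; apply: (@xgetPex _ a [set x | V x /\ f x = y]); exists x.
have gK x : V x -> g (f x) = x.
  move=> Vx; have [Vg fg] := gP _ (imageP f Vx).
  apply/eqP; rewrite -subr_eq0 -normr_le0; apply: le_trans (lip _ _ Vg Vx) _.
  by rewrite fg subrr normr0 mulr0.
have cg y : (f @` V) y -> {for y, continuous g}.
  move=> Wy; apply/continuous_normP => e e0.
  have dz : 0 < e / (2 * K) by rewrite divr_gt0// mulr_gt0.
  have N : \forall z \near y, `|y - z| < e / (2 * K).
    by have := nbhsx_ballx y _ dz; rewrite -ball_normE.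
  have N' : \forall z \near y, (f @` V) z by exact: open_nbhs_nbhs.
  apply: filterS2 N N' => z yz Wz.
  have [[Vgy fgy] [Vgz fgz]] := (gP _ Wy, gP _ Wz).
  apply: le_lt_trans (lip _ _ Vgy Vgz) _.
  by rewrite fgy fgz mulrC -ltr_pdivlMr// mulr_gt0.
have uJV x : V x -> 'J f x \in unitmx.
  move=> Vx; suff : 'J f x *m L \in unitmx by rewrite unitmx_mul => /andP[].
  rewrite -row_free_unit; apply: inj_row_free => v vJ.
  have := VJ x v Vx; rewrite -mulmxA vJ sub0r normrN => v2.
  apply/eqP; rewrite -normr_le0; move: v2; set u := `|v| => v2; lra.
have dg y : (f @` V) y -> differentiable g y /\ 'd g y = mulmxr (invmx ('J f (g y))) :> (_ -> _).
  move=> Wy; have [Vgy fgy] := gP _ Wy.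
  set D := invmx _; have cD := @linear_rV_continuous R n 'rV[R]_n (mulmxr D).
  have [K' K'0 DK] := linear_lipschitz cD.
  apply: remainder_le_diff cD _ => e e0.
  have e'0 : 0 < e / (K' * (2 * K)) by rewrite divr_gt0// !mulr_gt0.
  have H1 : \forall z \near y, `|f (g z) - f (g y) - 'd f (g y) (g z - g y)|
      <= e / (K' * (2 * K)) * `|g z - g y|.
    exact: cg _ Wy _ (diff_remainder_le (dfV _ Vgy) e'0).
  have N : \forall z \near y, (f @` V) z by exact: open_nbhs_nbhs.
  apply: filterS2 H1 N => z {}H1 Wz.
  have [Vgz fgz] := gP _ Wz.
  have -> : g z - g y - (z - y) *m D
      = - ((f (g z) - f (g y) - (g z - g y) *m 'J f (g y)) *m D).
    by rewrite (mulmxBl _ ((g z - g y) *m _)) mulmxK ?uJV// opprB fgz fgy.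
  rewrite normrN; apply: le_trans (DK _) _.
  rewrite diffE_jacobian in H1.
  apply: le_trans (ler_wpM2l (ltW K'0) H1) _.
  have c0 : 0 <= K' * (e / (K' * (2 * K))) by rewrite mulr_ge0// ltW.
  rewrite (mulrA K' (e / _)); apply: le_trans (ler_wpM2l c0 (lip _ _ Vgz Vgy)) _.
  rewrite fgz fgy (mulrA _ (2 * K)) le_eqVlt; apply/orP; left; apply/eqP; congr (_ * _).
  by field; rewrite !gt_eqF.
exists V, g; split=> //.
(* Bootstrap: g of class C^k makes dg = (J f \o g)^-1 of class C^k. *)
elim=> [|k IH]; first exact: cg.
split=> [y /dg[]//|v].
apply: (@eq_Ck _ _ _ _ _ (fun y => v *m invmx ('J f (g y)))) => //.
  by move=> y Wy; have [dgy dgyE] := dg _ Wy; rewrite deriveE// dgyE.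
apply: Ck_rV => // j; under eq_fun do rewrite mxE.
apply: Ck_sum => // i _; apply: CkM => //; first exact: Ck_cst.
apply: (@Ck_invmx R _ k _ n (fun y => 'J f (g y)) oW) => [y Wy|].
  by apply: uJV; exact: (gP _ Wy).1.
move=> i' j'.
have sub y : (f @` V) y -> A (g y) by move=> /gP[/VA].
have CD := Ck_comp oW oA sub IH ((sf k.+1).2 (delta_mx 0 i')).
apply: (eq_Ck oW _ (Ck_coord oW CD j')) => y /sub Ag.
by rewrite jacobianE//; exact: (sf 1).1.
Qed.

End InverseFunction.

(** * Fibers of maps of constant rank *)

Section AdaptedCoordinates.
Variables (F : fieldType) (m n : nat).

(** Completing the image of A to coordinates: u |-> u Q + (u A) P is invertible,
its last \rank A coordinates come from u A and the others from u alone.  With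
A = L I_r U, where I_r is a truncated identity, Q and P project after L and
after U^-1; the reversal S puts the components of u A last. *)
Lemma adapted_coordinates (A : 'M[F]_(m, n)) :
  exists (Q : 'M[F]_m) (P : 'M[F]_(n, m)),
  [/\ Q + A *m P \in unitmx, \rank Q = (m - \rank A)%N,
      forall i (j : 'I_m), (m - \rank A <= j)%N -> Q i j = 0
    & forall i (j : 'I_m), (j < m - \rank A)%N -> P i j = 0].
Proof.
set r := \rank A; have rm : (r <= m)%N := rank_leq_row A.
have rn : (r <= n)%N := rank_leq_col A.
pose S : 'M[F]_m := colsub (@rev_ord m) 1%:M.
have SM p (X : 'M[F]_(p, m)) i j : (X *m S) i j = X i (rev_ord j).
  by rewrite /S mulmx_colsub mulmx1 mxE.
have SS : S *m S = 1%:M.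
  by apply/matrixP => i j; rewrite SM !mxE rev_ordK.
have uS : S \in unitmx by case: (mulmx1_unit SS).
pose L := col_ebase A; pose U := row_ebase A.
exists (L *m copid_mx r *m S), (invmx U *m pid_mx r *m S); split.
- have AP : A *m (invmx U *m pid_mx r *m S) = L *m pid_mx r *m S.
    rewrite -{1}(mulmx_ebase A) -/r -/L -/U !mulmxA mulmxK ?row_ebase_unit//.
    by rewrite -[L *m _ *m pid_mx r]mulmxA pid_mx_id.
  rewrite AP -mulmxDl -mulmxDr subrK mulmx1.
  by rewrite unitmx_mul col_ebase_unit.
- rewrite mxrankMfree ?row_free_unit// eqmxMfull ?row_full_unit ?col_ebase_unit//.
  by rewrite rank_copid_mx.
- move=> i j dj; rewrite SM mxE big1// => k _; rewrite !mxE /=.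
  rewrite -val_eqE /=; case: eqVneq => [->|_]; last by rewrite subrr mulr0.
  rewrite (_ : (_ < r)%N) ?subrr ?mulr0//=.
  by have := ltn_ord j; move: dj => /=; lia.
- move=> i j dj; rewrite SM mxE big1// => k _; rewrite !mxE /=.
  case: eqVneq => [->|]; last by rewrite mulr0.
  rewrite (_ : (_ < r)%N = false) ?mulr0//=.
  by have := ltn_ord j; move: dj => /=; lia.
Qed.

(** As Q + J P is invertible, J P makes up for the rank missing in Q, which is
that of J; so J P has the rank of J, hence the same kernel. *)
Lemma kernel_of_projected_rank (Q : 'M[F]_m) (J : 'M[F]_(m, n)) (P : 'M[F]_(n, m)) p (u : 'M[F]_(p, m)) :
  Q + J *m P \in unitmx -> \rank Q = (m - \rank J)%N ->
  u *m J *m P = 0 -> u *m J = 0.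
Proof.
move=> uQ rQ uJP; apply: sub_kermxP.
have kJ : (kermx J <= kermx (J *m P))%MS.
  by apply/sub_kermxP; rewrite mulmxA mulmx_ker mul0mx.
have rJP : (\rank J <= \rank (J *m P))%N.
  have := mxrank_add Q (J *m P); rewrite mxrank_unit// rQ.
  have := rank_leq_row J; lia.
have : (kermx (J *m P) <= kermx J)%MS.
  rewrite -(geq_leqif (mxrank_leqif_sup kJ)) !mxrank_ker; lia.
by apply: submx_trans; apply/sub_kermxP; rewrite mulmxA.
Qed.

End AdaptedCoordinates.

Section ConstantRank.
Variables (R : realType) (m n : nat) (f : 'rV[R]_m -> 'rV[R]_n).
Variables (A : set 'rV[R]_m) (a : 'rV[R]_m).
Hypotheses (oA : open A) (Aa : A a) (sf : smooth_on A f).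
Hypothesis rankf : forall y, A y -> \rank ('J f y) = \rank ('J f a).

(** The coordinates are Phi y = (y - a) Q + (f y - f a) P, with Q and P adapted to
the Jacobian at a.  On the fiber the second term vanishes, hence so do the last
coordinates.  Conversely, moving along directions that only change the first
coordinates keeps (f y) P fixed to first order, and as the rank is constant this
keeps f y fixed to first order; integrating along the segment from 0 = Phi a to
Phi y inside a ball gives f y = f a. *)
Theorem constant_rank_fiber :
  exists (V : set 'rV[R]_m) (Phi Psi : 'rV[R]_m -> 'rV[R]_m),
  [/\ open_nbhs a V, V `<=` A & open (Phi @` V)] /\
  [/\ smooth_on V Phi, smooth_on (Phi @` V) Psi,
      forall y, V y -> Psi (Phi y) = y
    & forall y, V y -> f y = f a <->
        forall i : 'I_m, (m - \rank ('J f a) <= i)%N -> Phi y 0 i = 0 :> R].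
Proof.
set d := (m - _)%N.
have [Q [P [uQ rQ Q0 P0]]] := adapted_coordinates ('J f a).
pose Phi y := (y - a) *m Q + (f y - f a) *m P.
have sPhi : smooth_on A Phi.
  move=> k; apply: CkD => //; apply: Ck_mulmxr => //.
    by apply: CkD => //; [exact: Ck_id|exact: Ck_cst].
  by apply: CkD => //; exact: Ck_cst.
have dPhi y : A y -> differentiable Phi y /\ 'J Phi y = Q + 'J f y *m P.
  move=> Ay; have df : differentiable f y by exact: (sf 1).1.
  have cQ := @linear_rV_continuous R m 'rV[R]_m (mulmxr Q).
  have cP := @linear_rV_continuous R n 'rV[R]_m (mulmxr P).
  have [dP dPE] := diff_affine_sum a (f a) cQ cP df.
  split; first exact: dP.
  apply/row_matrixP => i; rewrite !rowE -diffE_jacobian.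
  apply: (etrans (dPE _)) => /=.
  by rewrite diffE_jacobian mulmxDr !mulmxA.
have uJ : 'J Phi a \in unitmx by rewrite (dPhi a Aa).2.
have [V0 [Psi [[oV0 V0a] V0A oW0 sPsi PsiK]]] := inverse_function oA Aa sPhi uJ.
have Phia : Phi a = 0 by rewrite /Phi !subrr !mul0mx addr0.
have : nbhs (0 : 'rV[R]_m) (Phi @` V0).
  by apply: open_nbhs_nbhs; split=> //; exists a.
move=> /nbhs_ballP[r /= r0 rW].
pose V := V0 `&` Phi @^-1` (ball 0 r).
have oV : open V.
  have cPhi x : V0 x -> {for x, continuous Phi}.
    by move=> /V0A Ax; exact: Ck_continuous (sPhi 0) _ Ax.
  by apply: (open_preimage_setI oV0 cPhi); exact: ball_open.
have PhiV : Phi @` V = ball 0 r.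
  apply/seteqP; split=> [_ [y [_ ry] <-]//|z rz].
  by have [y V0y yz] := rW z rz; exists y => //; split=> //=; rewrite yz.
have PsiP z : ball 0 r z -> V0 (Psi z) /\ Phi (Psi z) = z.
  by move=> /rW[y V0y <-]; rewrite PsiK.
exists V, Phi, Psi; split.
  split; last by rewrite PhiV; exact: ball_open.
  - by split=> //; split=> //=; rewrite Phia; exact: ballxx.
  - by move=> y [/V0A].
split.
- by move=> k; apply: Ck_sub (sPhi k) => y [/V0A].
- by move=> k; apply: Ck_sub (sPsi k); rewrite PhiV.
- by move=> y [V0y _]; exact: PsiK.
move=> y [V0y ry]; split.
  move=> fy i di; rewrite /Phi fy subrr mul0mx addr0 mxE big1// => k _.
  by rewrite Q0// mulr0.
set z := Phi y in ry * => z0.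
rewrite -(PsiK y V0y) -/z -(PsiK a V0a) Phia.
suff : `|f (Psi (0 + z)) - f (Psi 0)| <= 0.
  by rewrite add0r normr_le0 subr_eq0 => /eqP.
apply: (@le_diff_segment R _ n (f \o Psi)) => t t01.
have rt : ball 0 r (0 + t *: z).
  by apply: (ball_segment t01); [exact: ballxx|rewrite add0r].
set w := 0 + _ in rt *.
have [V0w Psiw] := PsiP w rt.
have dPsi : differentiable Psi w by apply: (sPsi 1).1; exact: rW.
have df : differentiable f (Psi w) by apply: (sf 1).1; exact: V0A.
have [dP dPE] := dPhi _ (V0A _ V0w).
split; first exact: differentiable_comp.
have JJ : 'J Psi w *m 'J Phi (Psi w) = 1%:M.
  rewrite -jacobian_comp//; apply/row_matrixP => i; rewrite !rowE mulmx1.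
  rewrite -diffE_jacobian -deriveE; last exact: differentiable_comp.
  transitivity ('D_(delta_mx 0 i) id w); last exact: derive_id.
  apply: near_eq_derive; have : ball 0 r w by [].
  move=> /(conj (@ball_open _ _ (0 : 'rV[R]_m) r)) /open_nbhs_nbhs H.
  by apply: filterS H => x /PsiP[].
have [_ uPhi] := mulmx1_unit JJ.
rewrite dPE in JJ uPhi.
set u := 'd Psi w z.
suff uJ0 : u *m 'J f (Psi w) = 0.
  have -> : 'd (f \o Psi) w z = u *m 'J f (Psi w).
    by rewrite /u 2!diffE_jacobian jacobian_comp// mulmxA.
  by rewrite uJ0 normr0.
have rQ' : \rank Q = (m - \rank ('J f (Psi w)))%N.
  have rw := rankf (V0A _ V0w); move: rw rQ.
  generalize ('J f (Psi w)) => Jw; generalize ('J f a) => Ja.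
  by move=> -> ->.
apply: (kernel_of_projected_rank uPhi rQ').
have uz : u *m Q + u *m 'J f (Psi w) *m P = z.
  by rewrite -mulmxA -mulmxDr /u diffE_jacobian -mulmxA JJ mulmx1.
(* The first coordinates of (u J) P vanish by the choice of P, the last ones are
   those of z because Q has none. *)
apply/rowP => j; rewrite [RHS]mxE.
have [jd|dj] := ltnP j d; first by rewrite mxE big1// => k _; rewrite P0// mulr0.
have := congr1 (fun v : 'rV_m => v 0 j) uz.
rewrite z0// mxE [X in X + _]mxE big1 ?add0r// => k _.
by rewrite Q0// mulr0.
Qed.

End ConstantRank.

(** * Ranks of matrices and bilinear forms *)

Section RankLemmas.
Variables (F : fieldType).

(** The rows of row_base form a basis of the image. *)
Lemma dim_limg_rank m n (f : {linear 'rV[F]_m -> 'rV[F]_n}) :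
  \dim (limg (linfun f)) = \rank (lin1_mx f).
Proof.
set A := lin1_mx f; pose B := row_base A.
pose X := [seq row i B | i <- enum 'I_(\rank A)].
have XE : <<X>>%VS = limg (linfun f).
  apply/eqP; rewrite eqEsubv; apply/andP; split.
    apply/span_subvP => _ /mapP[i _ ->].
    have /submxP[u uB] : (row i B <= A)%MS.
      by apply: submx_trans (row_sub _ _) _; rewrite eq_row_base.
    by rewrite uB mul_rV_lin1 -[f u](lfunE f) memv_img ?memvf.
  apply/subvP => _ /memv_imgP[u _ ->]; rewrite lfunE /= -mul_rV_lin1 -/A.
  have /submxP[w ->] : (u *m A <= B)%MS by rewrite eq_row_base submxMl.
  rewrite mulmx_sum_row; apply: memv_suml => i _; apply: memvZ.
  by apply: memv_span; apply/mapP; exists i => //; rewrite mem_enum.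
have fX : free X.
  pose Xt := [tuple row i B | i < \rank A].
  have -> : X = Xt by rewrite /X /=.
  apply/freeP => k; under eq_bigr do rewrite -tnth_nth tnth_mktuple.
  have -> : \sum_i k i *: row i B = (\row_i k i) *m B.
    by rewrite mulmx_sum_row; apply: eq_bigr => i _; rewrite mxE.
  move=> k0 i; have : \row_i k i = 0.
    by apply: (row_free_inj (row_base_free A)); rewrite k0 mul0mx.
  by move=> /rowP/(_ i); rewrite !mxE.
by rewrite -XE; move: fX; rewrite /free => /eqP ->; rewrite size_map size_enum_ord.
Qed.

Lemma dim_lker_rank m n (f : {linear 'rV[F]_m -> 'rV[F]_n}) :
  \dim (lker (linfun f)) = (m - \rank (lin1_mx f))%N.
Proof.
have := limg_ker_dim (linfun f) fullv; rewrite dim_limg_rank capfv dimvf /dim /=.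
by rewrite mul1n => mE; rewrite -[m in (m - _)%N]mE addnK.
Qed.

Lemma rank_left_right_inverse m n (A : 'M[F]_(m, n)) :
  exists P Q, P *m A *m Q = 1%:M :> 'M[F]_(\rank A).
Proof.
move: (mulmx_ebase A) (rank_leq_row A) (rank_leq_col A).
move: (col_ebase_unit A) (row_ebase_unit A).
move: (\rank A) (col_ebase A) (row_ebase A) => r L U uL uU <- rm rn.
exists (pid_mx r *m invmx L), (invmx U *m pid_mx r).
by rewrite !mulmxA mulmxKV// mulmxK// !pid_mx_id// pid_mx_1.
Qed.

End RankLemmas.

(** A matrix of rank r has an invertible compression P A Q of size r, and the
determinant of the compression remains nonzero nearby. *)
Lemma rank_lower_semicontinuous (R : realType) (V : normedModType R) m n
    (D : set V) (A : V -> 'M[R]_(m, n)) x : open D -> D x ->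
  (forall i j, CkR 0 D (fun y => A y i j)) ->
  \forall y \near x, (\rank (A x) <= \rank (A y))%N.
Proof.
move=> oD Dx cA.
have [P [Q PQ]] := rank_left_right_inverse (A x).
have cdet : CkR 0 D (fun y => \det (P *m A y *m Q)).
  apply: Ck_det => // i j.
  have -> : (fun y => (P *m A y *m Q) i j) =
      (fun y => \sum_l (\sum_k P i k * A y k l) * Q l j).
    by apply/funext => y; rewrite mxE; apply: eq_bigr => l _; rewrite mxE.
  apply: Ck_sum => // l _; apply: CkM => //; last exact: Ck_cst.
  by apply: Ck_sum => // k _; apply: CkM => //; exact: Ck_cst.
have det1 : \det (P *m A x *m Q) != 0 by rewrite PQ det1 oner_eq0.
have N : \forall y \near x, \det (P *m A y *m Q) != 0.
  exact: cvgr_neq0 (cdet x Dx) det1.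
apply: filterS N => y dy; have : P *m A y *m Q \in unitmx by rewrite unitmxE unitfE.
move=> /mxrank_unit <-; apply: leq_trans (mxrankM_maxl _ _) _.
exact: mxrankM_maxr.
Qed.

Section RankForm.
Variables (R : realFieldType) (m n : nat).
Variables (J : 'M[R]_(m, n)) (G : 'M[R]_m) (H : 'M[R]_n).

(** G and H stand for the metrics at a point and at its image, J for the
differential; the hypotheses are that G is definite and that J is isometric on
the G-orthogonal complement W of its kernel K.  The form C = G - J H J^T agrees
with G on K, so \rank C >= \dim K, and vanishes on W, so \rank C <= m - \dim W =
\dim K. *)
Lemma rank_isometry :
  (forall v : 'rV_m, v *m G *m v^T = 0 -> v = 0) ->
  (forall v w : 'rV_m,
    (forall k : 'rV_m, k *m J = 0 -> v *m G *m k^T = 0) ->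
    (forall k : 'rV_m, k *m J = 0 -> w *m G *m k^T = 0) ->
    v *m J *m H *m (w *m J)^T = v *m G *m w^T) ->
  (\rank J + \rank (G - J *m H *m J^T)%R = m)%N.
Proof.
move=> Gpos iso; set C := (G - _)%R.
have uG : G \in unitmx.
  rewrite -row_free_unit; apply: inj_row_free => v vG; apply: Gpos.
  by rewrite vG mul0mx.
have rJm := rank_leq_row J.
pose K := kermx J.
have rK : \rank K = (m - \rank J)%N by rewrite mxrank_ker.
have ge : (m - \rank J <= \rank C)%N.
  have KJ : K *m J = 0 by exact: mulmx_ker.
  have KC : K *m C = K *m G.
    by rewrite mulmxBr [X in _ - X]mulmxA [X in X *m J^T]mulmxA KJ !mul0mx subr0.
  rewrite -rK -(mxrankMfree _ (B := G)) ?row_free_unit// -KC; exact: mxrankM_maxr.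
pose W := kermx (G *m K^T).
have rW : \rank W = \rank J.
  rewrite mxrank_ker eqmxMfull ?row_full_unit// mxrank_tr rK; lia.
have WP (w : 'rV_m) : (w <= W)%MS -> forall k : 'rV_m, k *m J = 0 -> w *m G *m k^T = 0.
  move=> /sub_kermxP wK k /sub_kermxP/submxP[u ->].
  by rewrite trmx_mul mulmxA -(mulmxA w) wK mul0mx.
have KW0 : (K :&: W)%MS = 0.
  apply/eqP/rowV0P => v; rewrite sub_capmx => /andP[vK vW]; apply: Gpos.
  by apply: WP => //; exact/sub_kermxP.
have KWfull : row_full (K + W)%MS.
  rewrite /row_full; have := mxrank_sum_cap K W; rewrite KW0 mxrank0 rK rW; lia.
have WC : W *m C = 0.
  apply/row_matrixP => i; rewrite row_mul row0.
  have wW : (row i W <= W)%MS by exact: row_sub.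
  move: (row i W) wW => w wW.
  have CT : forall v : 'rV_m, w *m C *m v^T = 0.
    move=> v; have /sub_addsmxP[[a b] /= ->] : (v <= K + W)%MS by exact: submx_full.
    have KJ : a *m K *m J = 0 by rewrite -mulmxA mulmx_ker mulmx0.
    have -> : (a *m K + b *m W)^T = (a *m K)^T + (b *m W)^T by exact: linearD.
    rewrite mulmxDr /C mulmxBr !mulmxBl.
    rewrite (WP _ wW _ KJ) sub0r.
    have -> : w *m (J *m H *m J^T) *m (a *m K)^T = 0.
      by rewrite -!mulmxA -trmx_mul KJ trmx0 !mulmx0.
    rewrite oppr0 add0r -(iso w (b *m W)); last first.
    - by apply: WP; exact: submxMl.
    - exact: WP.
    by rewrite trmx_mul !mulmxA subrr.
  apply/rowP => j; have := CT (delta_mx 0 j); rewrite trmx_delta -colE => /rowP/(_ 0).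
  by rewrite !mxE.
have : (W <= kermx C)%MS by exact/sub_kermxP.
move=> /mxrankS; rewrite rW mxrank_ker.
by have := rank_leq_row C; lia.
Qed.

End RankForm.

(** * Parity of the kernel of a semi-slant map *)

Section DotForm.
Variables (R : realType) (n : nat) (g : {dot 'rV[R]_n for idfun}).

Lemma dotC X Y : g X Y = g Y X.
Proof. by rewrite (hermC g) expr0 mul1r. Qed.

Lemma dot_sumr X I (r : seq I) (c : I -> R) (b : I -> 'rV[R]_n) :
  g X (\sum_(i <- r) c i *: b i) = \sum_(i <- r) c i * g X (b i).
Proof. by rewrite linear_sumr; apply: eq_bigr => i _; rewrite linearZr_LR. Qed.

Lemma dot_suml Y I (r : seq I) (c : I -> R) (b : I -> 'rV[R]_n) :
  g (\sum_(i <- r) c i *: b i) Y = \sum_(i <- r) c i * g (b i) Y.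
Proof. by rewrite dotC dot_sumr; apply: eq_bigr => i _; rewrite dotC. Qed.

Lemma dot_eq0 X : g X X = 0 -> X = 0.
Proof.
by move=> gX; apply/eqP; apply: contraT => /(neq0_dnorm_gt0 (s := g)); rewrite gX ltxx.
Qed.

(** The matrix S of (X, Y) |-> g (J X) Y in a basis is skew and invertible, and
\det S = \det S^T = (-1)^k \det S. *)
Lemma even_dim_skew_form (J : 'End('rV[R]_n)) (U : {vspace 'rV[R]_n}) :
  (J \o J)%VF = - \1%VF -> (forall X Y, g (J X) (J Y) = g X Y) ->
  (forall X, X \in U -> {in U, forall Y, g (J X) Y = 0} -> X = 0) ->
  ~~ odd (\dim U).
Proof.
move=> JJ gJ nd; set k := \dim U.
have JJE X : J (J X) = - X.
  by have := congr1 (fun h : 'End(_) => h X) JJ; rewrite comp_lfunE opp_lfunE id_lfunE.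
have skew X Y : g (J X) Y = - g (J Y) X.
  by rewrite -gJ JJE linearNl dotC.
pose b := vbasis U.
pose S := \matrix_(i < k, j < k) g (J b`_i) b`_j.
have ST : S^T = - S by apply/matrixP => i j; rewrite !mxE skew.
have : S \in unitmx.
  rewrite -row_free_unit; apply: inj_row_free => u uS.
  pose X := \sum_(i < k) u 0 i *: b`_i.
  have XU : X \in U.
    apply: memv_suml => i _; apply: memvZ; apply: vbasis_mem.
    by apply: mem_nth; rewrite size_tuple.
  have X0 : X = 0.
    apply: nd => // Y /coord_vbasis ->; rewrite dot_sumr big1// => j _.
    have -> : J X = \sum_(i < k) u 0 i *: J b`_i.
      by rewrite /X linear_sum; apply: eq_bigr => i _; rewrite linearZ.
    rewrite dot_suml; have /rowP/(_ j) := uS; rewrite !mxE => uSj.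
    rewrite (_ : \sum_i _ = 0) ?mulr0// -[RHS]uSj.
    by apply: eq_bigr => i _; rewrite mxE.
  apply/rowP => i; rewrite mxE.
  by have /freeP := basis_free (vbasisP U); apply.
rewrite unitmxE unitfE; apply: contraNN => oddk.
have := det_tr S; rewrite ST -scaleN1r detZ -signr_odd oddk expr1 mulN1r => /eqP.
by rewrite eq_sym -subr_eq0 opprK -mulr2n mulrn_eq0 /= => /eqP ->.
Qed.

Lemma orthovI0 (W : {vspace 'rV[R]_n}) : (W :&: orthov g W = 0)%VS.
Proof.
apply/eqP; rewrite -subv0; apply/subvP => X.
rewrite memv_cap memv0 => /andP[XW /mem_orthovP XWo].
by apply/eqP/dot_eq0; exact: XWo.
Qed.

Lemma dim_orthovI (U W : {vspace 'rV[R]_n}) : (W <= U)%VS ->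
  \dim U = (\dim W + \dim (U :&: orthov g W))%N.
Proof.
move=> WU; set k := \dim W; set O := (U :&: orthov g W)%VS.
pose f (X : 'rV[R]_n) : 'rV[R]_k := \row_i g X (vbasis W)`_i.
have lf : linear f.
  by move=> a X Y; apply/rowP => i; rewrite !mxE linearDl linearZl_LR.
pose lfM := GRing.isLinear.Build _ _ _ _ _ lf.
pose fL : {linear 'rV[R]_n -> 'rV[R]_k} := HB.pack f lfM.
have kerf : (U :&: lker (linfun fL) <= O)%VS.
  apply/subvP => X; rewrite !memv_cap memv_ker => /andP[XU].
  rewrite XU lfunE => /eqP/rowP fX; apply/mem_orthovP => Y YW.
  suff : g X Y = 0 by [].
  rewrite (coord_vbasis YW) dot_sumr big1// => i _.
  by have := fX i; rewrite !mxE => ->; rewrite mulr0.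
have imf : (\dim (linfun fL @: U) <= k)%N.
  by apply: leq_trans (dimvS (subvf _)) _; rewrite dimvf /dim /= mul1n.
have := limg_ker_dim (linfun fL) U; have := dimvS kerf => dk dU.
have WO : (W :&: O = 0)%VS.
  apply/eqP; rewrite -subv0 -(orthovI0 W) subv_cap capvSl /=.
  by apply: subv_trans (capvSr _ _) (capvSr _ _).
have : (W + O <= U)%VS by rewrite subv_add WU capvSl.
move=> /dimvS; rewrite dimv_disjoint_sum// => ge.
by apply/eqP; rewrite eqn_leq ge andbT -dU addnC leq_add.
Qed.

(** The projection of v to W is 0, and acos 0 = pi / 2. *)
Lemma angle_orthogonal v (W : {vspace 'rV[R]_n}) : v \in orthov g W ->
  angle g v W = pi / 2.
Proof.
move=> vW; rewrite /angle.
have -> : daddv_pi W (orthov g W) v = 0.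
  have D := orthovI0 W; have D' : (orthov g W :&: W = 0)%VS by rewrite capvC.
  have vWW : v \in (W + orthov g W)%VS by apply: subvP vW; exact: addvSr.
  have := daddv_pi_add D vWW; rewrite (daddv_pi_id D' vW) => /eqP.
  by rewrite -subr_eq0 addrK => /eqP.
by rewrite linear0l sqrtr0 mul0r acos0.
Qed.

End DotForm.

Lemma even_dim_semi_slant_kernel (R : realType) (m n : nat) (M : manifold R m) (N : manifold R n)
    (gM : riemannian_metric M) (E : M -> {vspace 'End('rV[R]_m)}) (F : M -> N)
    (U : set M) J theta a q :
  almost_h_semi_slant_basis gM E F U J theta -> theta a <> pi / 2 -> U q ->
  ~~ odd (\dim (lker (differential F q))).
Proof.
move=> [[_ qb] slant] ta Uq; have [_ JJ _ _ gJ] := qb q Uq.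
have [D1 [_ D1ker JD1 slantD2 _]] := slant a.
rewrite (dim_orthovI (gM q) (D1ker q Uq)) oddD.
have := @even_dim_skew_form R m (gM q) (J a q) _ (JJ a) (gJ a).
move=> even; rewrite (negbTE (even (D1 q) _)) /=; last first.
  move=> X XD1 JX0; have JXD1 : J a q X \in D1 q.
    by have := memv_img (J a q) XD1; rewrite JD1.
  have := gJ a X X; rewrite JX0// => /esym; exact: dot_eq0.
apply: even => X XD2 JX0; apply: contrapT => /eqP Xn0; apply: ta.
rewrite -(slantD2 q X Uq XD2 Xn0).
by apply: angle_orthogonal; apply/mem_orthovP => Y YD2; exact: JX0.
Qed.

(** * Charts and change of coordinates *)

Section Charts.
Variables (R : realType) (T : topologicalType) (n : nat).
Implicit Types c : chart R T n.

Lemma chart_imgP c y : (chart_to c @` chart_dom c) y ->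
  chart_dom c (chart_inv c y) /\ chart_to c (chart_inv c y) = y.
Proof. by move=> [q cq <-]; rewrite chart_invK. Qed.

Lemma chart_imgE c (U : set T) : chart_to c @` (U `&` chart_dom c) =
  (chart_to c @` chart_dom c) `&` chart_inv c @^-1` U.
Proof.
apply/seteqP; split=> [_ [q [Uq cq] <-]|y [/chart_imgP[cy yE] Uy]].
  by split; [exists q|rewrite /= chart_invK].
by exists (chart_inv c y).
Qed.

Lemma chart_img_openI c (U : set T) : open U ->
  open (chart_to c @` (U `&` chart_dom c)).
Proof.
move=> oU; rewrite chart_imgE; apply: open_preimage_setI => //.
  exact: chart_img_open.
exact: chart_inv_continuous.
Qed.

Lemma near_chart c (U : set T) q : open U -> U q -> chart_dom c q ->
  \forall y \near chart_to c q, U (chart_inv c y) /\ (chart_to c @` chart_dom c) y.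
Proof.
move=> oU Uq cq; have oI := @chart_img_openI c U oU.
have : nbhs (chart_to c q) (chart_to c @` (U `&` chart_dom c)).
  by apply: open_nbhs_nbhs; split=> //; exists q.
by move=> N; apply: filterS N => y; rewrite chart_imgE => -[].
Qed.

Lemma transition_differentiable c1 c2 q : smooth_transition c1 c2 ->
  chart_dom c1 q -> chart_dom c2 q ->
  differentiable (chart_to c2 \o chart_inv c1) (chart_to c1 q).
Proof. by move=> /smooth_differentiable s c1q c2q; apply: s; exists q. Qed.

(** Chain rule for a change of charts: the differentials of G read in two charts
differ by the differential of the transition map. *)
Lemma diff_transition (W : normedModType R) c1 c2 q (G : T -> W) :
  smooth_transition c1 c2 -> chart_dom c1 q -> chart_dom c2 q ->
  differentiable (G \o chart_inv c2) (chart_to c2 q) ->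
  differentiable (G \o chart_inv c1) (chart_to c1 q) /\
  forall v, 'd (G \o chart_inv c1) (chart_to c1 q) v =
    'd (G \o chart_inv c2) (chart_to c2 q)
       ('d (chart_to c2 \o chart_inv c1) (chart_to c1 q) v).
Proof.
move=> s12 c1q c2q dG; have dt := transition_differentiable s12 c1q c2q.
have E : (chart_to c2 \o chart_inv c1) (chart_to c1 q) = chart_to c2 q.
  by rewrite /= chart_invK.
rewrite -E in dG *; apply: near_eq_diff_comp => //.
have N := near_chart (chart_dom_open c2) c2q c1q.
by apply: filterS N => y [c2y c1y]; rewrite /= chart_invK.
Qed.

End Charts.

Section Frame.
Variables (R : realType) (n : nat) (M : manifold R n).

(** frame p q v is the vector at q with components v in the chart at p, whose
domain should contain q; frame p q is then the inverse of coord_change p q.  For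
fixed v the field q |-> frame p q v is a
combination of the coordinate fields of the chart at p with constant
coefficients. *)
Definition frame (p q : M) : 'rV[R]_n -> 'rV[R]_n :=
  'd (chart_to (chart_at M q) \o chart_inv (chart_at M p)) (chart_to (chart_at M p) q).

Lemma transition_smooth (p q : M) : smooth_transition (chart_at M p) (chart_at M q).
Proof. exact: (chart_at_compatible p q).1. Qed.

Lemma diff_chart_id (p q : M) (v : 'rV[R]_n) : chart_dom (chart_at M p) q ->
  'd (chart_to (chart_at M p) \o chart_inv (chart_at M p)) (chart_to (chart_at M p) q) v = v.
Proof.
move=> pq; have dt := transition_differentiable (transition_smooth p p) pq pq.
rewrite -deriveE//; transitivity ('D_v (@id 'rV[R]_n) (chart_to (chart_at M p) q)).
  apply: near_eq_derive; have N := near_chart openT I pq.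
  by apply: filterS N => y [_ /chart_imgP[]].
exact: derive_id.
Qed.

Lemma frameK (p q : M) (v : 'rV[R]_n) : chart_dom (chart_at M p) q ->
  coord_change p q (frame p q v) = v.
Proof.
move=> pq; have qq := chart_at_dom q.
have dt := transition_differentiable (transition_smooth q p) qq pq.
have [_ E] := diff_transition (transition_smooth p q) pq qq dt.
by rewrite /coord_change /frame -E diff_chart_id.
Qed.

Lemma coord_changeK (p q : M) (v : 'rV[R]_n) : chart_dom (chart_at M p) q ->
  frame p q (coord_change p q v) = v.
Proof.
move=> pq; have qq := chart_at_dom q.
have dt := transition_differentiable (transition_smooth p q) pq qq.
have [_ E] := diff_transition (transition_smooth q p) qq pq dt.
by rewrite /coord_change /frame -E diff_chart_id.
Qed.

Lemma frame_smooth (p : M) (v : 'rV[R]_n) :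
  smooth_field (chart_dom (chart_at M p)) (fun q => frame p q v).
Proof.
move=> p' k; set D := _ @` _.
have oD : open D by exact/chart_img_openI/chart_dom_open.
pose D' := chart_to (chart_at M p) @` (chart_dom (chart_at M p) `&` chart_dom (chart_at M p')).
have oD' : open D'.
  by rewrite /D' setIC; exact/chart_img_openI/chart_dom_open.
pose h := 'D_v (chart_to (chart_at M p') \o chart_inv (chart_at M p)).
apply: (@eq_Ck _ _ _ _ _ (h \o (chart_to (chart_at M p) \o chart_inv (chart_at M p')))) => //.
  move=> _ [q [pq p'q] <-]; rewrite /h /= !chart_invK//.
  have qq := chart_at_dom q.
  have d1 := transition_differentiable (transition_smooth p p') pq p'q.
  have d2 := transition_differentiable (transition_smooth q p') qq p'q.
  have [_ E] := diff_transition (transition_smooth p q) pq qq d2.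
  by rewrite deriveE// E.
apply: (Ck_comp (B := D')) => //.
- move=> _ [q [pq p'q] <-] /=; rewrite chart_invK//; by exists q.
- by rewrite /D setIC; exact: transition_smooth.
- exact: (transition_smooth p p' k.+1).2.
Qed.

(** The metric is only given as smooth on smooth fields; evaluating it on
coordinate fields makes its components in a fixed chart continuous. *)
Lemma metric_continuous (g : riemannian_metric M) (p : M) (v w : 'rV[R]_n) :
  CkR 0 (chart_to (chart_at M p) @` chart_dom (chart_at M p))
    (fun y => g (chart_inv (chart_at M p) y) (frame p (chart_inv (chart_at M p) y) v)
       (frame p (chart_inv (chart_at M p) y) w)).
Proof.
have := metric_smooth g (chart_dom_open (chart_at M p)) (frame_smooth p v) (frame_smooth p w).
by move=> /(_ p 0); rewrite setIid.
Qed.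

End Frame.

(** * Rank of a Riemannian map *)

Lemma gramE (R : realType) m n (g : {dot 'rV[R]_n for idfun})
    (l : {linear 'rV[R]_m -> 'rV[R]_n}) (v w : 'rV[R]_m) :
  v *m (\matrix_(i, j) g (l (delta_mx 0 i)) (l (delta_mx 0 j))) *m w^T
  = (g (l v) (l w))%:M.
Proof.
apply/matrixP => i j; rewrite (ord1 i) (ord1 j) [RHS]mxE eqxx mulr1n.
have lE (u : 'rV[R]_m) : l u = \sum_k u 0 k *: l (delta_mx 0 k).
  by rewrite [in LHS](row_sum_delta u) linear_sum; apply: eq_bigr => k _; rewrite linearZ.
rewrite (lE w) dot_sumr mxE; apply: eq_bigr => k _; rewrite mulrC [w^T _ _]mxE.
congr (_ * _); rewrite (lE v) dot_suml mxE; apply: eq_bigr => l' _.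
by rewrite mxE.
Qed.

Lemma rank_equivalent (K : fieldType) m n (A B : 'M[K]_(m, n)) S T :
  S \in unitmx -> T \in unitmx -> S *m A = B *m T -> \rank A = \rank B.
Proof.
move=> uS uT E; rewrite -(mxrankMfree B (B := T)) ?row_free_unit// -E.
by rewrite eqmxMfull// row_full_unit.
Qed.

Lemma complementary_ranks (r1 r2 c1 c2 k : nat) : (r1 <= r2)%N -> (c1 <= c2)%N ->
  (r1 + c1 = k)%N -> (r2 + c2 = k)%N -> r2 = r1.
Proof. lia. Qed.

Section LocalExpression.
Variables (R : realType) (m n : nat) (M : manifold R m) (N : manifold R n).
Variables (F : M -> N) (sF : smooth_map F).

Definition local_dom (p : M) (x : N) : set M :=
  chart_dom (chart_at M p) `&` F @^-1` chart_dom (chart_at N x).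

Definition local_expr (p : M) (x : N) : 'rV[R]_m -> 'rV[R]_n :=
  chart_to (chart_at N x) \o F \o chart_inv (chart_at M p).

Lemma local_dom_open p x :
  open (chart_to (chart_at M p) @` local_dom p x).
Proof.
rewrite /local_dom setIC; apply: chart_img_openI.
have [cF _] := sF; apply: open_comp; last exact: chart_dom_open.
by move=> q _; exact: cF.
Qed.

Lemma local_expr_diff p x q : local_dom p x q ->
  differentiable (local_expr p x) (chart_to (chart_at M p) q).
Proof. by move=> pxq; apply: smooth_differentiable (sF.2 p x) _; exists q. Qed.

(** The differential at q is defined with the charts at q and F q; this is its
expression in fixed charts at p and x, needed to vary q. *)
Lemma differential_frame p x q v : local_dom p x q ->
  differential F q (frame p q v) =
  frame x (F q) ('d (local_expr p x) (chart_to (chart_at M p) q) v).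
Proof.
move=> pxq; have [pq xFq] := pxq.
have qq := chart_at_dom q; have Fqq := chart_at_dom (F q).
have qFq : local_dom q (F q) q by [].
have dq := local_expr_diff qFq.
have dpx := local_expr_diff pxq.
have [dp E] := diff_transition (G := chart_to (chart_at N (F q)) \o F)
  (transition_smooth p q) pq qq dq.
transitivity ('d ((chart_to (chart_at N (F q)) \o F) \o chart_inv (chart_at M p))
                 (chart_to (chart_at M p) q) v).
  apply: (etrans _ (esym (E v))); exact: lfunE.
have dN := transition_differentiable (transition_smooth x (F q)) xFq Fqq.
have pxqE : local_expr p x (chart_to (chart_at M p) q) = chart_to (chart_at N x) (F q).
  by rewrite /local_expr /= chart_invK.
rewrite /frame -pxqE in dN *.
have [|_ dcomp] := near_eq_diff_comp (h := (chart_to (chart_at N (F q)) \o F) \o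
  chart_inv (chart_at M p)) dpx dN; last exact: dcomp.
have oD := @local_dom_open p x.
have ND : nbhs (chart_to (chart_at M p) q) (chart_to (chart_at M p) @` local_dom p x).
  by apply: open_nbhs_nbhs; split=> //; exists q.
apply: filterS ND => _ [s [ps xFs] <-].
by rewrite /local_expr /= !chart_invK.
Qed.

Lemma rank_differential p x q : local_dom p x q ->
  \dim (lker (differential F q)) =
  (m - \rank ('J (local_expr p x) (chart_to (chart_at M p) q)))%N.
Proof.
move=> pxq; have [pq xFq] := pxq.
apply: (etrans (dim_lker_rank _)); apply: (congr1 (subn m)).
set Jq := lin1_mx _; set J := 'J _ _.
have JqE v : v *m Jq = differential F q v by rewrite mul_rV_lin1 /differential lfunE.
pose S := lin1_mx ('d (chart_to (chart_at M q) \o chart_inv (chart_at M p)) (chart_to (chart_at M p) q)).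
pose S' := lin1_mx ('d (chart_to (chart_at M p) \o chart_inv (chart_at M q)) (chart_to (chart_at M q) q)).
pose T := lin1_mx ('d (chart_to (chart_at N (F q)) \o chart_inv (chart_at N x)) (chart_to (chart_at N x) (F q))).
pose T' := lin1_mx ('d (chart_to (chart_at N x) \o chart_inv (chart_at N (F q))) (chart_to (chart_at N (F q)) (F q))).
have SS' : S *m S' = 1%:M.
  apply/row_matrixP => i; rewrite !rowE mulmxA !mul_rV_lin1 mulmx1; exact: frameK.
have TT' : T *m T' = 1%:M.
  apply/row_matrixP => i; rewrite !rowE mulmxA !mul_rV_lin1 mulmx1; exact: frameK.
have SJ : S *m Jq = J *m T.
  apply/row_matrixP => i; rewrite !rowE !mulmxA JqE !mul_rV_lin1.
  exact: differential_frame.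
have [uS _] := mulmx1_unit SS'; have [uT _] := mulmx1_unit TT'.
exact: rank_equivalent uS uT SJ.
Qed.

Variables (gM : riemannian_metric M) (gN : riemannian_metric N).
Hypothesis rF : riemannian_map gM gN F.

Definition gram_at (k : nat) (P : manifold R k) (g : riemannian_metric P) (p : P)
    (y : 'rV[R]_k) : 'M[R]_k :=
  let q := chart_inv (chart_at P p) y in
  \matrix_(i, j) g q (frame p q (delta_mx 0 i)) (frame p q (delta_mx 0 j)).

(** The matrix in the chart at p of the metric of M minus the pullback of the
metric of N. *)
Definition defect_form p x y : 'M[R]_m :=
  gram_at gM p y - 'J (local_expr p x) y *m gram_at gN x (local_expr p x y)
                   *m ('J (local_expr p x) y)^T.

Lemma rank_defect_form p x q : local_dom p x q ->
  let y := chart_to (chart_at M p) q in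
  (\rank ('J (local_expr p x) y) + \rank (defect_form p x y) = m)%N.
Proof.
move=> pxq y; have [pq xFq] := pxq.
have yE : chart_inv (chart_at M p) y = q by rewrite chart_invK.
have fyE : chart_inv (chart_at N x) (local_expr p x y) = F q.
  by rewrite /local_expr /= yE chart_invK.
have GE (v w : 'rV_m) : v *m gram_at gM p y *m w^T = (gM q (frame p q v) (frame p q w))%:M.
  by rewrite /gram_at yE; exact: gramE.
have HE (v w : 'rV_n) : v *m gram_at gN x (local_expr p x y) *m w^T =
   (gN (F q) (frame x (F q) v) (frame x (F q) w))%:M.
  by rewrite /gram_at fyE; exact: gramE.
have frame0 v : frame p q v = 0 -> v = 0.
  by move=> v0; rewrite -[v](frameK v pq) v0 /coord_change linear0.
have frameN0 v : frame x (F q) v = 0 -> v = 0.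
  by move=> v0; rewrite -[v](frameK v xFq) v0 /coord_change linear0.
have scal0 (a : R) : a%:M = 0 :> 'M[R]_1 -> a = 0.
  by move=> /matrixP/(_ 0 0); rewrite !mxE eqxx.
apply: rank_isometry.
  by move=> v; rewrite GE => /scal0/dot_eq0/frame0.
move=> v w vK wK.
have orth (u : 'rV_m) : (forall k : 'rV_m, k *m 'J (local_expr p x) y = 0 ->
    u *m gram_at gM p y *m k^T = 0) ->
    frame p q u \in orthov (gM q) (lker (differential F q)).
  move=> uK; apply/mem_orthovP => Z; rewrite memv_ker => /eqP FZ.
  suff : gM q (frame p q u) Z = 0 by [].
  rewrite -(coord_changeK Z pq); apply: scal0; rewrite -GE; apply: uK.
  rewrite -diffE_jacobian; apply: frameN0.
  by rewrite -differential_frame// coord_changeK.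
rewrite HE GE -!diffE_jacobian -!differential_frame//.
by rewrite rF.2//; exact: orth.
Qed.

Lemma gram_continuous (k : nat) (P : manifold R k) (g : riemannian_metric P) (p : P) i j :
  CkR 0 (chart_to (chart_at P p) @` chart_dom (chart_at P p))
    (fun y => gram_at g p y i j).
Proof.
have H := @metric_continuous R k P g p (delta_mx 0 i) (delta_mx 0 j).
by apply: (eq_Ck (@chart_img_open _ _ _ (chart_at P p)) _ H) => y _; rewrite mxE.
Qed.

Lemma defect_form_continuous p x i j :
  CkR 0 (chart_to (chart_at M p) @` local_dom p x) (fun y => defect_form p x y i j).
Proof.
set D := _ @` _; have oD : open D by exact: local_dom_open.
have DM : D `<=` chart_to (chart_at M p) @` chart_dom (chart_at M p).
  by move=> _ [q [pq _] <-]; exists q.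
have cJ a b : CkR 0 D (fun y => 'J (local_expr p x) y a b).
  exact: (Ck_jacobian oD (sF.2 p x 1)).
have cH k l : CkR 0 D (fun y => gram_at gN x (local_expr p x y) k l).
  move=> y Dy; apply: (@continuous_comp _ _ _ (local_expr p x) (fun z => gram_at gN x z k l)).
    by apply: differentiable_continuous; exact: (sF.2 p x 1).1.
  apply: gram_continuous; move: Dy => [q [pq xFq] <-].
  by exists (F q) => //; rewrite /local_expr /= chart_invK.
have -> : (fun y => defect_form p x y i j) = (fun y => gram_at gM p y i j +
    (-1) * \sum_l (\sum_k 'J (local_expr p x) y i k * gram_at gN x (local_expr p x y) k l)
             * 'J (local_expr p x) y j l).
  apply/funext => y; rewrite /defect_form mxE; congr (_ + _).
  rewrite [LHS]mxE mulN1r; congr (- _); rewrite mxE; apply: eq_bigr => l _.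
  by rewrite mxE; congr (_ * _); rewrite mxE.
apply: CkD => //; first by apply: (Ck_sub DM); exact: gram_continuous.
apply: CkM => //; first exact: Ck_cst.
apply: Ck_sum => // l _; apply: CkM => //.
by apply: Ck_sum => // k _; apply: CkM.
Qed.

Lemma rank_locally_constant p x q : local_dom p x q ->
  \forall y \near chart_to (chart_at M p) q,
    \rank ('J (local_expr p x) y) =
    \rank ('J (local_expr p x) (chart_to (chart_at M p) q)).
Proof.
move=> pxq; set a := chart_to _ q.
set D := chart_to (chart_at M p) @` local_dom p x.
have oD : open D by exact: local_dom_open.
have Da : D a by exists q.
have ND : \forall y \near a, D y by exact: open_nbhs_nbhs.
have N1 := rank_lower_semicontinuous oD Da (Ck_jacobian oD (sF.2 p x 1)).
have N2 := rank_lower_semicontinuous oD Da (@defect_form_continuous p x).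
apply: filterS (filterI ND (filterI N1 N2)) => _ [[s pxs <-] [J1 C1]].
exact: complementary_ranks J1 C1 (rank_defect_form pxq) (rank_defect_form pxs).
Qed.

End LocalExpression.

(** * The fibers as submanifolds *)

(** The level sets of d are open and closed. *)
Lemma locally_constant_component (T : topologicalType) (X : Type) (d : T -> X) :
  (forall p, \forall q \near p, d q = d p) ->
  forall p q, connected_component [set: T] p q -> d p = d q.
Proof.
move=> dloc p q [C [Cp _ conC] Cq].
have openD (P : X -> Prop) : open [set s | P (d s)].
  by rewrite openE => s Ps; have N := dloc s; apply: filterS N => t /= ->.
suff /seteqP[_ CE] : C `&` [set s | d s = d p] = C by have [_ /esym] := CE q Cq.
apply: conC; first by exists p.
- by exists [set s | d s = d p] => //; exact: (openD (fun k => k = d p)).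
- exists [set s | d s = d p] => //.
  have -> : [set s | d s = d p] = ~` [set s | d s <> d p].
    by apply/seteqP; split=> s /=; [move=> -> | move=> /contrapT].
  by apply: open_closedC; exact: (openD (fun k => k <> d p)).
Qed.

Section ChartRestriction.
Variables (R : realType) (n : nat) (M : manifold R n) (p : M).
Variables (V : set 'rV[R]_n) (Phi Psi : 'rV[R]_n -> 'rV[R]_n).
Let c := chart_at M p.
Hypotheses (oV : open V) (VD : V `<=` chart_to c @` chart_dom c).
Hypotheses (oW : open (Phi @` V)) (sPhi : smooth_on V Phi).
Hypotheses (sPsi : smooth_on (Phi @` V) Psi) (PhiK : forall y, V y -> Psi (Phi y) = y).

(** A chart composed with a diffeomorphism of an open part of its image is
again compatible with the atlas. *)
Lemma compatible_chart : exists c' : chart R M n,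
  [/\ chart_dom c' = chart_dom c `&` chart_to c @^-1` V,
      forall q, chart_to c' q = Phi (chart_to c q)
    & forall q, compatible c' (chart_at M q)].
Proof.
pose dom := chart_dom c `&` chart_to c @^-1` V.
have oD : open dom.
  apply: (open_preimage_setI (chart_dom_open c) _ oV).
  exact: chart_to_continuous.
have imgE : (Phi \o chart_to c) @` dom = Phi @` V.
  apply/seteqP; split=> [_ [q [_ Vq] <-]|_ [y Vy <-]]; first by exists (chart_to c q).
  have [q cq yq] := VD Vy.
  by exists q; rewrite /dom /= yq.
have oI : open ((Phi \o chart_to c) @` dom) by rewrite imgE.
have invK q : dom q -> (chart_inv c \o Psi) ((Phi \o chart_to c) q) = q.
  by move=> [cq Vq]; rewrite /= PhiK// chart_invK.
have cto q : dom q -> {for q, continuous (Phi \o chart_to c)}.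
  move=> [cq Vq]; apply: continuous_comp; first exact: chart_to_continuous.
  exact: (Ck_continuous (sPhi 0)).
have cinv z : ((Phi \o chart_to c) @` dom) z -> {for z, continuous (chart_inv c \o Psi)}.
  move=> [q [cq Vq] <-]; apply: continuous_comp.
    by apply: (Ck_continuous (sPsi 0)); exists (chart_to c q).
  by rewrite /= PhiK//; apply: chart_inv_continuous; exists q.
exists (Chart oD oI invK cto cinv); split=> // q; split; rewrite /smooth_transition /=.
- set A := _ @` _ => k.
  have oA : open A.
    rewrite /A setIC.
    exact: (@chart_img_openI _ _ _ (Chart oD oI invK cto cinv) _ (chart_dom_open (chart_at M q))).
  pose B := chart_to c @` (chart_dom c `&` chart_dom (chart_at M q)).
  have oB : open B by rewrite /B setIC; exact/chart_img_openI/chart_dom_open.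
  apply: (@Ck_comp R _ n n k A B Psi (chart_to (chart_at M q) \o chart_inv c) oA oB).
  + move=> _ [s [[cs Vs] qs] <-]; rewrite /= PhiK//; by exists s.
  + apply: Ck_sub (sPsi k) => _ [s [[cs Vs] qs] <-]; by exists (chart_to c s).
  + exact: (transition_smooth p q k).
- set A := _ @` _ => k.
  have oA : open A by rewrite /A setIC; exact/chart_img_openI.
  apply: (@Ck_comp R _ n n k A V (chart_to c \o chart_inv (chart_at M q)) Phi oA oV).
  + by move=> _ [s [qs [cs Vs]] <-]; rewrite /= chart_invK.
  + by apply: Ck_sub (transition_smooth q p k) => _ [s [qs [cs Vs]] <-]; exists s.
  + exact: sPhi.
Qed.

End ChartRestriction.

Section Fibers.
Variables (R : realType) (m n : nat) (M : manifold R m) (N : manifold R n).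
Variables (gM : riemannian_metric M) (gN : riemannian_metric N) (F : M -> N).
Hypothesis rF : riemannian_map gM gN F.

Let fiber_dim (q : M) := \dim (lker (differential F q)).

Lemma fiber_dim_locally_constant (p : M) : \forall q \near p, fiber_dim q = fiber_dim p.
Proof.
have sF := rF.1; have pp := chart_at_dom p; have FpFp := chart_at_dom (F p).
have pxp : local_dom F p (F p) p by [].
have NR := rank_locally_constant sF rF pxp.
have N1 : \forall q \near p, \rank ('J (local_expr F p (F p)) (chart_to (chart_at M p) q)) =
    \rank ('J (local_expr F p (F p)) (chart_to (chart_at M p) p)).
  exact: chart_to_continuous pp _ NR.
have N2 : \forall q \near p, chart_dom (chart_at M p) q.
  by apply: open_nbhs_nbhs; split=> //; exact: chart_dom_open.
have N3 : \forall q \near p, chart_dom (chart_at N (F p)) (F q).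
  apply: sF.1; apply: open_nbhs_nbhs; split=> //; exact: chart_dom_open.
apply: filterS (filterI N1 (filterI N2 N3)) => q [Nq [pq Fq]].
apply: (etrans (rank_differential sF (conj pq Fq))).
apply: (etrans (congr1 (subn m) Nq)).
exact: esym (rank_differential sF pxp).
Qed.

(** The diffeomorphism Phi that flattens the fibers of the local expression of F
in the chart at p turns that chart into one adapted to the fiber through p. *)
Lemma fiber_submanifold (x : N) : submanifold (F @^-1` [set x]) fiber_dim.
Proof.
have sF := rF.1.
move=> p /= Fpx; have pp := chart_at_dom p.
split; first by apply: leq_trans (dimvS (subvf _)) _; rewrite dimvf /dim /= mul1n.
have pxp : local_dom F p x p by split=> //=; rewrite Fpx; exact: chart_at_dom.
set c := chart_at M p in pp *; set f := local_expr F p x; set a := chart_to c p.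
set D := chart_to c @` local_dom F p x.
have oD : open D by exact: local_dom_open.
pose A := D `&` interior [set y | \rank ('J f y) = \rank ('J f a)].
have oA : open A by apply: openI => //; exact: open_interior.
have NR := rank_locally_constant sF rF pxp.
have Aa : A a by split; [exists p|exact: NR].
have sf : smooth_on A f by move=> k; apply: Ck_sub (sF.2 p x k) => y [].
have rf y : A y -> \rank ('J f y) = \rank ('J f a).
  by move=> [_ /interior_subset].
have [V [Phi [Psi [[[oV Va] VA oW] [sPhi sPsi PhiK fV]]]]] :=
  constant_rank_fiber oA Aa sf rf.
have VD : V `<=` chart_to c @` chart_dom c.
  by move=> y /VA[[q [cq _] <-] _]; exists q.
have [c' [domc' toc' compc']] := compatible_chart oV VD oW sPhi sPsi PhiK.
exists c'; split=> //; first by rewrite domc'.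
have fibE q : chart_dom c q -> V (chart_to c q) -> (F q = x <-> f (chart_to c q) = f a).
  move=> cq /VA[[q' [cq' xFq'] qq'] _].
  have xFq : chart_dom (chart_at N x) (F q).
    by rewrite -(chart_invK cq) -qq' chart_invK.
  rewrite /f /a /local_expr /= !chart_invK// Fpx; split=> [->//|E].
  by rewrite -(chart_invK xFq) E chart_invK//; exact: chart_at_dom.
have dE : fiber_dim p = (m - \rank ('J f a))%N := rank_differential sF pxp.
rewrite domc'; apply/seteqP; split=> q /=.
  move=> [Fq [cq Vq]]; split=> // i di; rewrite toc'.
  apply: ((fV _ Vq).1 ((fibE q cq Vq).1 Fq)).
  by apply: leq_trans di; rewrite dE.
move=> [[cq Vq] zq]; split=> //; apply/(fibE q cq Vq)/(fV _ Vq) => i di.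
by rewrite -toc'; apply: zq; rewrite dE.
Qed.

End Fibers.

Theorem theorem3p9 (R : realType) (m n : nat)
    (M : manifold R (4 * m)) (N : manifold R n)
    (gM : riemannian_metric M) (gN : riemannian_metric N)
    (E : M -> {vspace 'End('rV[R]_(4 * m))}) (F : M -> N)
    (hE : almost_quaternionic_hermitian gM E)
    (hF : almost_h_semi_slant_map gM gN E F)
    (hangles : forall p : M, exists U J theta,
      [/\ open_nbhs p U, almost_h_semi_slant_basis gM E F U J theta
        & ~ (forall a, theta a = pi / 2)])
    (x : N) (hx : F @^-1` [set x] !=set0) :
  exists d : M -> nat,
    [/\ submanifold (F @^-1` [set x]) d,
        forall p q, connected_component [set: M] p q -> d p = d q
      & forall p, ~~ odd (d p)].
Proof.
have rF := hF.1.
exists (fun q => \dim (lker (differential F q))); split.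
- exact: fiber_submanifold rF x.
- exact: locally_constant_component (fiber_dim_locally_constant rF).
- move=> p; have [U [J [theta [[_ Up] slant /existsNP[a theta_a]]]]] := hangles p.
  exact: even_dim_semi_slant_kernel slant theta_a Up.
Qed.
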